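(* Let $B>0$, $c\in(0,\tfrac{1}{2B}]$, and let $\phi\in L^2(\mathbb{R})$ be such that $\mathcal{A}\phi(0,\omega)\neq0$ and $\mathcal{A}\phi(c,\omega)\neq0$ for almost every $\omega\in(-2B,2B)$. Then for all $f,g\in\mathrm{PW}^2_B$ the following are equivalent: (1) $f=e^{i\alpha}g$ for some $\alpha\in\mathbb{R}$; (2) $|\mathcal{V}_\phi f(x,\omega)|=|\mathcal{V}_\phi g(x,\omega)|$ for all $x,\omega\in\mathbb{R}$.
   Context: For $B>0$, the Paley--Wiener space is $\mathrm{PW}^2_B:=\{f:\mathbb{C}\to\mathbb{C} \mid \exists F\in L^2([-B,B])\ \forall z\in\mathbb{C}: f(z)=\int_{-B}^B F(\xi)e^{2\pi i \xi z}\,d\xi\}$; its elements are identified with their restrictions to $\mathbb{R}$ (which lie in $L^2(\mathbb{R})$) when transforms are applied. For $f,\phi\in L^2(\mathbb{R})$ the short-time Fourier transform is $\mathcal{V}_\phi f(x,\omega)=\int_{\mathbb{R}} f(t)\overline{\phi(t-x)}e^{-2\pi i t\omega}\,dt$, and the ambiguity function of $f\in L^2(\mathbb{R})$ is $\mathcal{A}f(x,\omega):=e^{\pi i x\omega}\mathcal{V}_f f(x,\omega)$, for $x,\omega\in\mathbb{R}$. *)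

(* Defs.v *)
From HB Require Import structures.
From mathcomp Require Import all_boot all_order all_algebra.
From mathcomp Require Import all_classical all_reals all_analysis.
From mathcomp Require Import complex.
Set Implicit Arguments. Unset Strict Implicit. Unset Printing Implicit Defensive.
Import Order.TTheory GRing.Theory Num.Theory.
Import numFieldNormedType.Exports.
Local Open Scope classical_set_scope.
Local Open Scope ring_scope.
Local Open Scope complex_scope.

Section Defs.
Variable R : realType.
Local Notation mu := (@lebesgue_measure R).

Definition expi (t : R) : R[i] := cos t +i* sin t.

Definition cexp (z : R[i]) : R[i] := (expR (complex.Re z))%:C * expi (complex.Im z).

Definition cnorm2 (z : R[i]) : R := complex.Re z ^+ 2 + complex.Im z ^+ 2.

Definition cintegral (D : set R) (f : R -> R[i]) : R[i] :=
  (Rintegral mu D (fun t => complex.Re (f t))) +i* (Rintegral mu D (fun t => complex.Im (f t))).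

Definition L2on (D : set R) (f : R -> R[i]) : Prop :=
  measurable_fun D (fun t => complex.Re (f t)) /\ measurable_fun D (fun t => complex.Im (f t)) /\
  mu.-integrable D (fun t => (cnorm2 (f t))%:E).

Definition L2 (f : R -> R[i]) : Prop := L2on setT f.

Definition PW2 (B : R) (f : R[i] -> R[i]) : Prop :=
  exists F : R -> R[i], L2on `[- B, B] F /\
    forall z : R[i], f z = cintegral `[- B, B]
       (fun xi => F xi * cexp ((2 * pi * xi)%:C * 'i * z)).

Definition STFT (phi f : R -> R[i]) (x w : R) : R[i] :=
  cintegral setT (fun t => f t * (phi (t - x))^* * expi (- (2 * pi * t * w))).

Definition ambiguity (f : R -> R[i]) (x w : R) : R[i] :=
  expi (pi * x * w) * STFT f f x w.

End Defs.

(* Main.v *)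
(* Fix [x]. The function [w |-> |V_phi f (x, w)|^2] is the Fourier transform of the autocorrelation of
   [t |-> f t * conj (phi (t - x))], so (2) makes these autocorrelations agree almost everywhere, and
   everywhere by continuity of translation in [L^2]. At lag [s] the autocorrelation is, as a function
   of [x], the convolution of [f (s + e) * conj (f e)], whose spectrum [D] lies in [[-2B, 2B]], with a
   window whose Fourier transform is [ambiguity phi s] up to a unimodular factor. The latter does not
   vanish on [(-2B, 2B)], hence [f (s + e) * conj (f e)] is determined for [s = 0] and [s = c]. Thus
   [|f| = |g|] and [f / g] is constant along [t0 + c Z] for any [t0] such that [g] has no zero on
   [t0 + c Z]; one exists because the zeros of [g] are isolated. As [c <= 1 / (2B)], the samples on
   [t0 + c Z] determine a band-limited function.

   All the uniqueness statements (Fourier transform, Fourier coefficients, moments) come from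
   [rint_threshold]: if the powers of a bounded function [v] annihilate an integrable [u], so do the
   indicators of the sublevel sets of [v]. *)

(* In each use of [rint_threshold] the function [v] is chosen so that its sublevel sets are
   intervals: genuine ones for [v = (t - y) ^ 2], intervals modulo a period when [v] is the negative
   of a cosine. Lebesgue differentiation then turns vanishing integrals over small intervals into
   vanishing almost everywhere. The period decides what a family of frequencies determines. If all
   frequencies are available the period may tend to infinity; frequencies in [c Z] give the period
   [1 / c], which is at least the length [2B] of the band exactly when [c <= 1 / (2B)].

   Equality of autocorrelations for almost every lag would say nothing about the two lags [0] and
   [c]; this is why continuity in the lag is needed.

   The spectra [F] and [G] carry the argument: having bounded support, they are integrable as well
   as square integrable. Square integrability of [f] on the line comes from Bessel's inequality, and
   the isolation of zeros from Rolle's theorem applied to real and imaginary parts. Neither Fourier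
   inversion nor complex analysis enters. *)
Require Import Defs.
From HB Require Import structures.
From mathcomp Require Import all_boot all_order all_algebra.
From mathcomp Require Import all_classical all_reals all_analysis.
From mathcomp Require Import measurable_realfun complex ring lra.
Set Implicit Arguments.
Unset Strict Implicit.
Import Order.TTheory GRing.Theory Num.Theory.
Import numFieldNormedType.Exports.
Local Open Scope classical_set_scope.
Local Open Scope ring_scope.
Local Open Scope complex_scope.

(** * Real integrals *)

Section RealIntegral.
Context d (T : measurableType d) (R : realType) (m : {measure set T -> \bar R}).

Definition rintegrable (u : T -> R) := m.-integrable setT (EFin \o u).

Definition rint (u : T -> R) : R := Rintegral m setT u.

Lemma rintegrable_measurable (u : T -> R) : rintegrable u -> measurable_fun setT u.
Proof. by move=> /measurable_int/measurable_EFinP. Qed.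

Lemma rintegrable0 : rintegrable (fun=> 0).
Proof. exact: integrable0. Qed.

Lemma rintegrableD (u v : T -> R) :
  rintegrable u -> rintegrable v -> rintegrable (fun t => u t + v t).
Proof. by move=> iu iv; exact: (integrableD measurableT iu iv). Qed.

Lemma rintegrableN (u : T -> R) : rintegrable u -> rintegrable (fun t => - u t).
Proof. by move=> iu; exact: (integrableN iu). Qed.

Lemma rintegrableB (u v : T -> R) :
  rintegrable u -> rintegrable v -> rintegrable (fun t => u t - v t).
Proof. by move=> iu iv; exact/rintegrableD/rintegrableN. Qed.

Lemma rintegrableZ (a : R) (u : T -> R) :
  rintegrable u -> rintegrable (fun t => a * u t).
Proof. by move=> iu; exact: (integrableZl measurableT a iu). Qed.

Lemma rintegrable_norm (u : T -> R) : rintegrable u -> rintegrable (fun t => `|u t|).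
Proof. by move=> iu; exact: integrable_norm. Qed.

Lemma rintegrable_le (u v : T -> R) : measurable_fun setT u ->
  (forall t, `|u t| <= v t) -> rintegrable v -> rintegrable u.
Proof.
move=> mu uv; apply: le_integrable => //; first exact/measurable_EFinP.
by move=> t _ /=; rewrite lee_fin (le_trans (uv t)) ?ler_norm.
Qed.

Lemma rintegrable_eq (u v : T -> R) : u =1 v -> rintegrable u -> rintegrable v.
Proof. by move=> /funext ->. Qed.

Lemma rintegrableM_bounded (u k : T -> R) (M : R) : rintegrable u ->
  measurable_fun setT k -> (forall t, `|k t| <= M) -> rintegrable (fun t => u t * k t).
Proof.
move=> iu mk kM; have mu := rintegrable_measurable iu.
apply: (@rintegrable_le _ (fun t => M * `|u t|)).
- exact: measurable_funM.
- by move=> t; rewrite normrM mulrC ler_wpM2r.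
- exact/rintegrableZ/rintegrable_norm.
Qed.

Lemma rintegrableM_square (u v : T -> R) :
  measurable_fun setT u -> measurable_fun setT v ->
  rintegrable (fun t => u t ^+ 2) -> rintegrable (fun t => v t ^+ 2) ->
  rintegrable (fun t => u t * v t).
Proof.
move=> mu mv iu iv; apply: rintegrable_le (rintegrableD iu iv).
  exact: measurable_funM.
move=> t; rewrite normrM -(real_normK (num_real (u t))) -(real_normK (num_real (v t))).
have := sqr_ge0 (`|u t| - `|v t|); have := normr_ge0 (u t); have := normr_ge0 (v t).
by nra.
Qed.

Lemma rintD (u v : T -> R) : rintegrable u -> rintegrable v ->
  rint (fun t => u t + v t) = rint u + rint v.
Proof. exact: RintegralD. Qed.

Lemma rintB (u v : T -> R) : rintegrable u -> rintegrable v ->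
  rint (fun t => u t - v t) = rint u - rint v.
Proof. exact: RintegralB. Qed.

Lemma rintZ (a : R) (u : T -> R) : rintegrable u ->
  rint (fun t => a * u t) = a * rint u.
Proof. exact: RintegralZl. Qed.

Lemma rint0 : rint (fun=> 0) = 0.
Proof. by rewrite /rint Rintegral_cst// mul0r. Qed.

Lemma rintN (u : T -> R) : rintegrable u -> rint (fun t => - u t) = - rint u.
Proof.
move=> iu; rewrite -mulN1r -rintZ//; apply: eq_Rintegral => t _; exact/esym/mulN1r.
Qed.

Lemma rint_ge0 (u : T -> R) : (forall t, 0 <= u t) -> 0 <= rint u.
Proof. by move=> u0; apply: Rintegral_ge0. Qed.

Lemma rint_le (u v : T -> R) : rintegrable u -> rintegrable v ->
  (forall t, u t <= v t) -> rint u <= rint v.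
Proof. by move=> iu iv uv; apply: le_Rintegral. Qed.

Lemma norm_rint (u : T -> R) : rintegrable u -> `|rint u| <= rint (fun t => `|u t|).
Proof. exact: le_normr_Rintegral. Qed.

Lemma rint_ae (u v : T -> R) : measurable_fun setT u -> measurable_fun setT v ->
  {ae m, forall t, u t = v t} -> rint u = rint v.
Proof.
move=> mu mv uv; congr fine; apply: ae_eq_integral => //; try exact/measurable_EFinP.
by apply: filterS uv => t /= ->.
Qed.

Lemma rintE (u : T -> R) : rintegrable u -> (rint u)%:E = (\int[m]_t (u t)%:E)%E.
Proof. by move=> iu; rewrite /rint /Rintegral fineK//; exact: integrable_fin_num. Qed.

(** Meant for Fubini's theorem: a partial integral with extended values is known to agree with its
    real-valued version only where the section is integrable, that is, almost everywhere. *)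
Lemma rintegrable_ae (f : T -> \bar R) (u : T -> R) : m.-integrable setT f ->
  measurable_fun setT u -> {ae m, forall t, f t = (u t)%:E} -> rintegrable u.
Proof.
move=> /integrableP[mf fi] mu fu; apply/integrableP; split; first exact/measurable_EFinP.
apply: le_lt_trans fi; rewrite le_eqVlt; apply/orP; left; apply/eqP.
apply: ae_eq_integral => //.
- exact/measurableT_comp/measurable_EFinP.
- exact: measurableT_comp.
- by apply: filterS fu => t /= ->.
Qed.

Lemma rintE_ae (f : T -> \bar R) (u : T -> R) : m.-integrable setT f ->
  measurable_fun setT u -> {ae m, forall t, f t = (u t)%:E} ->
  (rint u)%:E = (\int[m]_t f t)%E.
Proof.
move=> fi mu fu; rewrite rintE; last exact: rintegrable_ae fi mu fu.
apply: ae_eq_integral => //; [exact/measurable_EFinP|exact: measurable_int fi|].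
by apply: filterS fu => t /= ->.
Qed.

Lemma rint_dominated_cvg (u_ : nat -> T -> R) (u g : T -> R) :
  (forall n, measurable_fun setT (u_ n)) -> measurable_fun setT u ->
  {ae m, forall t, u_ ^~ t @ \oo --> u t} -> rintegrable g ->
  (forall n t, `|u_ n t| <= g t) -> (fun n => rint (u_ n)) @ \oo --> rint u.
Proof.
move=> mu_ mu cvgu ig ug.
have := @dominated_convergence _ _ _ m _ measurableT (fun n => EFin \o u_ n)
  (EFin \o u) (EFin \o g).
case=> //.
- by move=> n; exact/measurable_EFinP.
- exact/measurable_EFinP.
- by apply: filterS cvgu => t ut _; apply/fine_cvgP; split; [exact: nearW|exact: ut].
- by apply: aeW => t n _; rewrite lee_fin.
move=> iu _ cv; apply: fine_cvg; rewrite rintE//; exact: cv.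
Qed.

Lemma rint_dominated_limit (u_ : nat -> T -> R) (u g : T -> R) :
  (forall n, measurable_fun setT (u_ n)) ->
  (forall t, u_ ^~ t @ \oo --> u t) -> rintegrable g ->
  (forall n t, `|u_ n t| <= g t) ->
  [/\ rintegrable u, (forall t, `|u t| <= g t) & (fun n => rint (u_ n)) @ \oo --> rint u].
Proof.
move=> mu_ cvgu ig ug.
have ub t : `|u t| <= g t.
  have cn : (fun n => `|u_ n t|) @ \oo --> `|u t| by apply: cvg_norm.
  rewrite -(cvg_lim _ cn)//; apply: limr_le; first exact: cvgP cn.
  by apply: nearW => n; exact: ug.
have mu : measurable_fun setT u.
  by apply: measurable_fun_cvg; [exact: mu_|move=> t _; exact: cvgu].
split=> //; first exact: rintegrable_le ig.
by apply: (rint_dominated_cvg (g := g)) => //; exact: aeW.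
Qed.

Lemma ae_imply (P Q : T -> Prop) : (forall t, P t -> Q t) ->
  {ae m, forall t, P t} -> {ae m, forall t, Q t}.
Proof. by move=> PQ; apply: filterS. Qed.

Lemma ae_imply2 (P Q S : T -> Prop) : (forall t, P t -> Q t -> S t) ->
  {ae m, forall t, P t} -> {ae m, forall t, Q t} -> {ae m, forall t, S t}.
Proof. by move=> PQS; apply: filterS2. Qed.

End RealIntegral.

(** * Translations and Fubini for the Lebesgue measure *)

Section Translation.
Variable R : realType.
Local Notation mu := (@lebesgue_measure R).

Lemma measurable_addl (a : R) : measurable_fun setT (fun t : R => t + a).
Proof. by apply: measurable_funD. Qed.

(** By uniqueness of Lebesgue measure it is enough to compare both measures on half-open
    intervals. *)
Lemma lebesgue_measure_translation (a : R) (A : set R) : measurable A ->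
  pushforward mu ((fun t => t + a) : _ -> measurableTypeR R) A = mu A.
Proof.
move=> mA; apply/esym/lebesgue_measure_unique => //=.
  exact: measurable_addl.
move=> _ _ [[x y]] _ <-.
rewrite /pushforward.
have -> : (fun t => t + a) @^-1` `]x, y]%classic = `](x - a), (y - a)]%classic.
  by apply/seteqP; split => t /=; rewrite !in_itv/= ltrBlDr lerBrDr.
by rewrite !lebesgue_measure_itv/= !lte_fin ltrD2r; case: ifP => // _; rewrite -!EFinB; congr EFin; ring.
Qed.

Lemma ge0_integral_translation (a : R) (f : R -> \bar R) : measurable_fun setT f ->
  (forall t, (0 <= f t)%E) -> (\int[mu]_t f (t + a)%R = \int[mu]_t f t)%E.
Proof.
move=> mf f0.
have := @ge0_integral_pushforward _ _ (measurableTypeR R) (measurableTypeR R) R (fun t : R => t + a)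
  (measurable_addl a) mu setT f measurableT mf (fun t _ => f0 t).
rewrite preimage_setT => <-; apply: eq_measure_integral => [|? A mA _]; first exact: measurable_addl.
exact: lebesgue_measure_translation.
Qed.

Lemma rintegrable_translation (a : R) (u : R -> R) :
  rintegrable mu u -> rintegrable mu (fun t => u (t + a)).
Proof.
move=> /integrableP[mf fi]; have mu' := mf; move/measurable_EFinP in mu'.
have mua : measurable_fun setT (fun t : R => u (t + a)).
  by apply: measurableT_comp => //; exact: measurable_addl.
apply/integrableP; split; first exact/measurable_EFinP.
by rewrite (@ge0_integral_translation a (fun t => `|(EFin \o u) t|%E))//; exact: measurableT_comp.
Qed.

Lemma rint_translation (a : R) (u : R -> R) : rintegrable mu u ->
  rint mu (fun t => u (t + a)) = rint mu u.
Proof.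
move=> iu; have mf := measurable_int _ iu.
have := @integral_pushforward _ _ (measurableTypeR R) (measurableTypeR R) R (fun t : R => t + a)
  (measurable_addl a) mu setT (EFin \o u) mf (rintegrable_translation a iu) measurableT.
rewrite preimage_setT => H; congr fine; rewrite -[LHS]H.
apply: eq_measure_integral => [|? A mA _]; first exact: measurable_addl.
by move: mA; exact: lebesgue_measure_translation.
Qed.

End Translation.

Section RealFubini.
Variable R : realType.
Local Notation mu := (@lebesgue_measure R).

Lemma rintegrable2_mul (u v : R -> R) : rintegrable mu u -> rintegrable mu v ->
  rintegrable (mu \x mu)%E (fun z => u z.1 * v z.2).
Proof.
move=> iu iv; have mu_ := rintegrable_measurable iu; have mv := rintegrable_measurable iv.
apply/integrable12ltyP.
  apply/measurable_EFinP; apply: measurable_funM; exact: measurableT_comp.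
rewrite /=; under eq_integral => x _.
  under eq_integral do rewrite normrM EFinM.
  rewrite ge0_integralZl//; last by apply/measurable_EFinP/measurableT_comp.
  over.
have fin (w : R -> R) : rintegrable mu w -> (\int[mu]_t `|w t|%:E = (rint mu (fun t => `|w t|))%:E)%E.
  by move=> iw; rewrite rintE//; exact: rintegrable_norm.
rewrite fin//; under eq_integral do rewrite -EFinM mulrC EFinM.
rewrite ge0_integralZl//.
- by rewrite fin// -EFinM ltry.
- by apply/measurable_EFinP/measurableT_comp.
- by rewrite lee_fin rint_ge0.
Qed.

(** The order of integration matters: with [z.2] frozen, translation invariance removes it from the
    first factor and the double integral splits into a product. *)
Lemma rintegrable2_mul_translation (u v : R -> R) : rintegrable mu u -> rintegrable mu v ->
  rintegrable (mu \x mu)%E (fun z => u (z.1 + z.2) * v z.2).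
Proof.
move=> iu iv; have mu_ := rintegrable_measurable iu; have mv := rintegrable_measurable iv.
apply/integrable21ltyP.
  apply/measurable_EFinP; apply: measurable_funM; last exact: measurableT_comp.
  by apply: measurableT_comp => //; exact: measurable_funD.
have fin (w : R -> R) : rintegrable mu w -> (\int[mu]_t `|w t|%:E = (rint mu (fun t => `|w t|))%:E)%E.
  by move=> iw; rewrite rintE//; exact: rintegrable_norm.
rewrite /=; under eq_integral => y _.
  under eq_integral do rewrite normrM mulrC EFinM.
  rewrite ge0_integralZl//; last first.
    apply/measurable_EFinP/measurableT_comp => //.
    by apply: measurableT_comp => //; exact: measurable_addl.
  rewrite (@ge0_integral_translation _ y (fun t => `|u t|%:E))//; last first.
    by apply/measurable_EFinP/measurableT_comp.
  rewrite fin// -EFinM mulrC EFinM.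
  over.
rewrite ge0_integralZl//.
- by rewrite fin// -EFinM ltry.
- by apply/measurable_EFinP/measurableT_comp.
- by rewrite lee_fin rint_ge0.
Qed.

Lemma rint_fubini (h : R * R -> R) : rintegrable (mu \x mu)%E h ->
  [/\ {ae mu, forall x, rintegrable mu (fun y => h (x, y))},
      rintegrable mu (fun x => rint mu (fun y => h (x, y))),
      rintegrable mu (fun y => rint mu (fun x => h (x, y))) &
      rint mu (fun x => rint mu (fun y => h (x, y))) =
      rint mu (fun y => rint mu (fun x => h (x, y)))].
Proof.
move=> ih.
have iF := integrable_fubini_F ih; have mh := measurable_int _ ih.
have iG : mu.-integrable setT (fubini_G mu (EFin \o h)).
  apply/integrableP; split; first exact: (measurable_fubini_G ih).
  have fin := (integrable21ltyP mu mu mh).1 ih.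
  apply: (le_lt_trans _ fin); apply: ge0_le_integral => //.
  - by apply: measurableT_comp => //; exact: (measurable_fubini_G ih).
  - apply: (measurable_fun_fubini_tonelli_G (m1 := mu) (abse \o (EFin \o h))) => //=.
    exact: measurableT_comp.
  - move=> y _; apply: le_abse_integral => //; apply: measurableT_comp => //.
have eF : {ae mu, forall x, fubini_F mu (EFin \o h) x = (rint mu (fun y => h (x, y)))%:E}.
  apply: filterS (ae_integrable1 ih) => x hx.
  by rewrite rintE.
have eG : {ae mu, forall y, fubini_G mu (EFin \o h) y = (rint mu (fun x => h (x, y)))%:E}.
  apply: filterS (ae_integrable2 ih) => x hx.
  by rewrite rintE.
have mF : measurable_fun setT (fun x : R => rint mu (fun y => h (x, y))).
  have := measurable_int _ iF => m; apply: measurableT_comp m.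
  exact: fine_measurable.
have mG : measurable_fun setT (fun y : R => rint mu (fun x => h (x, y))).
  have := measurable_int _ iG => m; apply: measurableT_comp m.
  exact: fine_measurable.
have rF : rintegrable mu (fun x => rint mu (fun y => h (x, y))).
  by exact: (rintegrable_ae iF).
have rG : rintegrable mu (fun y => rint mu (fun x => h (x, y))).
  by exact: (rintegrable_ae iG).
split; [exact: ae_integrable1 ih|exact: rF|exact: rG|].
apply: EFin_inj; rewrite (rintE_ae iF mF eF) (rintE_ae iG mG eG).
by rewrite integral12_prod_meas1// integral21_prod_meas1.
Qed.

End RealFubini.

(** * Complex integrals *)

Section ComplexAlgebra.
Variable R : realType.
Implicit Types (a b z : R[i]) (s t : R).

Lemma ReM a b : complex.Re (a * b) =
  complex.Re a * complex.Re b - complex.Im a * complex.Im b.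
Proof. by case: a; case: b. Qed.

Lemma ImM a b : complex.Im (a * b) =
  complex.Re a * complex.Im b + complex.Im a * complex.Re b.
Proof. by case: a; case: b. Qed.

Lemma ReD a b : complex.Re (a + b) = complex.Re a + complex.Re b.
Proof. by case: a; case: b. Qed.

Lemma ImD a b : complex.Im (a + b) = complex.Im a + complex.Im b.
Proof. by case: a; case: b. Qed.

Lemma ReB a b : complex.Re (a - b) = complex.Re a - complex.Re b.
Proof. by case: a; case: b. Qed.

Lemma ImB a b : complex.Im (a - b) = complex.Im a - complex.Im b.
Proof. by case: a; case: b. Qed.

Lemma ReN z : complex.Re (- z) = - complex.Re z.
Proof. by case: z. Qed.

Lemma ImN z : complex.Im (- z) = - complex.Im z.
Proof. by case: z. Qed.

(* [conjc] is written out: inside a product, [z^*] is the convertible [Num.conj] of [ring_scope]. *)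
Lemma ReJ z : complex.Re (conjc z) = complex.Re z.
Proof. by case: z. Qed.

Lemma ImJ z : complex.Im (conjc z) = - complex.Im z.
Proof. by case: z. Qed.

Lemma complex_ext a b : complex.Re a = complex.Re b -> complex.Im a = complex.Im b -> a = b.
Proof. by case: a; case: b => /= ? ? ? ? -> ->. Qed.

Definition ReImE := (ReM, ImM, ReD, ImD, ReN, ImN, ReJ, ImJ).

Lemma conjcM a b : conjc (a * b) = conjc a * conjc b.
Proof. by apply: complex_ext; rewrite !ReImE; ring. Qed.

Lemma cnorm2_ge0 z : 0 <= cnorm2 z.
Proof. by rewrite addr_ge0 ?sqr_ge0. Qed.

Lemma cnorm2M a b : cnorm2 (a * b) = cnorm2 a * cnorm2 b.
Proof. by rewrite /cnorm2 !ReImE; ring. Qed.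

Lemma cnorm2J z : cnorm2 (conjc z) = cnorm2 z.
Proof. by rewrite /cnorm2 !ReImE sqrrN. Qed.

Lemma cnorm2_eq0 z : (cnorm2 z == 0) = (z == 0).
Proof.
rewrite /cnorm2 paddr_eq0 ?sqr_ge0// !sqrf_eq0.
by case: z => x y; rewrite eq_complex.
Qed.

Lemma mulcJ z : z * conjc z = (cnorm2 z)%:C.
Proof. by rewrite /cnorm2; apply: complex_ext; rewrite !ReImE/=; ring. Qed.

Lemma cnorm2_normc z : (cnorm2 z)%:C = `|z| ^+ 2.
Proof. by rewrite sqr_normc mulcJ. Qed.

Lemma normc_eq_cnorm2 a b : (`|a| = `|b|) <-> (cnorm2 a = cnorm2 b).
Proof.
split=> [e|e]; first by apply: (@complexI R); rewrite !cnorm2_normc e.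
by rewrite !normc_def; move: e; rewrite /cnorm2 => ->.
Qed.

Lemma expiD s t : expi (s + t) = expi s * expi t.
Proof. by apply: complex_ext; rewrite !ReImE/= ?cosD ?sinD; ring. Qed.

Lemma expiN t : expi (- t) = conjc (expi t).
Proof. by apply: complex_ext; rewrite !ReImE/= ?cosN ?sinN. Qed.

Lemma expi0 : expi 0 = 1 :> R[i].
Proof. by rewrite /expi cos0 sin0. Qed.

Lemma cnorm2_expi t : cnorm2 (expi t) = 1.
Proof. exact: cos2Dsin2. Qed.

Lemma expi_neq0 t : expi t != 0.
Proof. by rewrite -cnorm2_eq0 cnorm2_expi oner_neq0. Qed.

Lemma norm_Re_expi t : `|complex.Re (expi t)| <= 1.
Proof. exact: cos_max. Qed.

Lemma norm_Im_expi t : `|complex.Im (expi t)| <= 1.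
Proof. exact: sin_max. Qed.

(** [acos] gives an angle with nonnegative sine, so the sign of the imaginary part decides between
    [acos x] and its opposite. *)
Lemma normc1_expi z : cnorm2 z = 1 -> exists t, z = expi t.
Proof.
case: z => x y; rewrite /cnorm2/= => xy.
have xI : -1 <= x <= 1.
  by rewrite -ler_norml -(@ler_pXn2r _ 2)// ?nnegrE// expr1n real_normK ?num_real// -xy lerDl sqr_ge0.
have sy : Num.sqrt (1 - x ^+ 2) = `|y| by rewrite -xy addrAC subrr add0r sqrtr_sqr.
have [y0|y0] := leP 0 y.
  exists (acos x); rewrite /expi acosK ?in_itv//= sin_acos// sy ger0_norm//.
exists (- acos x); rewrite /expi cosN sinN acosK ?in_itv//= sin_acos// sy.
by rewrite ltr0_norm// opprK.
Qed.

End ComplexAlgebra.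

Section ComplexIntegral.
Context d (T : measurableType d) (R : realType) (m : {measure set T -> \bar R}).
Implicit Types f g k : T -> R[i].

Definition cmeasurable f := measurable_fun setT (fun t => complex.Re (f t)) /\
  measurable_fun setT (fun t => complex.Im (f t)).

Definition cintegrable f := rintegrable m (fun t => complex.Re (f t)) /\
  rintegrable m (fun t => complex.Im (f t)).

(** For Lebesgue measure this unfolds to [cintegral setT], so [STFT] is a [cint] by conversion. *)
Definition cint f : R[i] :=
  rint m (fun t => complex.Re (f t)) +i* rint m (fun t => complex.Im (f t)).

Lemma cmeasurable_cst (z : R[i]) : cmeasurable (fun=> z).
Proof. by split. Qed.

Lemma cmeasurableM f g : cmeasurable f -> cmeasurable g -> cmeasurable (fun t => f t * g t).
Proof.
move=> [f1 f2] [g1 g2]; split.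
  by under eq_fun do rewrite ReM; apply: measurable_funB; exact: measurable_funM.
by under eq_fun do rewrite ImM; apply: measurable_funD; exact: measurable_funM.
Qed.

Lemma cmeasurableB f g : cmeasurable f -> cmeasurable g -> cmeasurable (fun t => f t - g t).
Proof.
move=> [f1 f2] [g1 g2]; split.
  by under eq_fun do rewrite ReB; exact: measurable_funB.
by under eq_fun do rewrite ImB; exact: measurable_funB.
Qed.

Lemma cmeasurableJ f : cmeasurable f -> cmeasurable (fun t => conjc (f t)).
Proof.
move=> [f1 f2]; split; first by under eq_fun do rewrite ReJ.
by under eq_fun do rewrite ImJ; exact: measurable_funN.
Qed.

Lemma cmeasurable_expi (u : T -> R) : measurable_fun setT u ->
  cmeasurable (fun t => expi (u t)).
Proof.
move=> mu; split => /=; apply: measurableT_comp => //.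
  by apply: continuous_measurable_fun; exact: continuous_cos.
by apply: continuous_measurable_fun; exact: continuous_sin.
Qed.

Lemma measurable_cnorm2 f : cmeasurable f -> measurable_fun setT (fun t => cnorm2 (f t)).
Proof. by move=> [f1 f2]; rewrite /cnorm2; apply: measurable_funD; apply: measurable_funX. Qed.

Lemma cintegrable_measurable f : cintegrable f -> cmeasurable f.
Proof. by move=> [/rintegrable_measurable f1 /rintegrable_measurable f2]. Qed.

Lemma cintegrableB f g : cintegrable f -> cintegrable g -> cintegrable (fun t => f t - g t).
Proof.
move=> [f1 f2] [g1 g2]; split.
  by under eq_fun do rewrite ReB; exact: rintegrableB.
by under eq_fun do rewrite ImB; exact: rintegrableB.
Qed.

Lemma cintegrableJ f : cintegrable f -> cintegrable (fun t => conjc (f t)).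
Proof.
move=> [f1 f2]; split; first by under eq_fun do rewrite ReJ.
by under eq_fun do rewrite ImJ; exact: rintegrableN.
Qed.

Lemma cintegrableM_bounded f k (M : R) : cintegrable f -> cmeasurable k ->
  (forall t, `|complex.Re (k t)| <= M) -> (forall t, `|complex.Im (k t)| <= M) ->
  cintegrable (fun t => f t * k t).
Proof.
move=> [f1 f2] [k1 k2] kM1 kM2; split.
  under eq_fun do rewrite ReM.
  by apply: rintegrableB; exact: rintegrableM_bounded.
under eq_fun do rewrite ImM.
by apply: rintegrableD; exact: rintegrableM_bounded.
Qed.

Lemma cintegrableM_expi f (u : T -> R) : cintegrable f -> measurable_fun setT u ->
  cintegrable (fun t => f t * expi (u t)).
Proof.
move=> fi mu; apply: (cintegrableM_bounded fi (cmeasurable_expi mu)) => t.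
  exact: norm_Re_expi.
exact: norm_Im_expi.
Qed.

Lemma cintegrableZ (z : R[i]) f : cintegrable f -> cintegrable (fun t => z * f t).
Proof.
move=> [f1 f2]; split.
  by under eq_fun do rewrite ReM; apply: rintegrableB; exact: rintegrableZ.
by under eq_fun do rewrite ImM; apply: rintegrableD; exact: rintegrableZ.
Qed.

Lemma cintegrable_eq f g : f =1 g -> cintegrable f -> cintegrable g.
Proof. by move=> /funext ->. Qed.

Lemma cint_eq f g : f =1 g -> cint f = cint g.
Proof. by move=> /funext ->. Qed.

Lemma cintB f g : cintegrable f -> cintegrable g ->
  cint (fun t => f t - g t) = cint f - cint g.
Proof.
move=> [f1 f2] [g1 g2]; apply: complex_ext; rewrite ?ReImE/=.
  by rewrite -rintB//; congr rint; apply/funext => t; rewrite ReB.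
by rewrite -rintB//; congr rint; apply/funext => t; rewrite ImB.
Qed.

Lemma cintD f g : cintegrable f -> cintegrable g ->
  cint (fun t => f t + g t) = cint f + cint g.
Proof.
move=> [f1 f2] [g1 g2]; apply: complex_ext; rewrite ?ReImE/=.
  by rewrite -rintD//; congr rint; apply/funext => t; rewrite ReD.
by rewrite -rintD//; congr rint; apply/funext => t; rewrite ImD.
Qed.

Lemma cintZ (z : R[i]) f : cintegrable f -> cint (fun t => z * f t) = z * cint f.
Proof.
move=> [f1 f2]; apply: complex_ext; rewrite ?ReImE/=.
  rewrite -!rintZ// -rintB; try exact: rintegrableZ.
  by congr rint; apply/funext => t; rewrite ReM.
rewrite -!rintZ// -rintD; try exact: rintegrableZ.
by congr rint; apply/funext => t; rewrite ImM.
Qed.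

Lemma cintJ f : cintegrable f -> cint (fun t => conjc (f t)) = conjc (cint f).
Proof.
move=> [f1 f2]; apply: complex_ext; rewrite ?ReImE/=.
  by congr rint; apply/funext => t; rewrite ReJ.
by rewrite -rintN//; congr rint; apply/funext => t; rewrite ImJ.
Qed.

Lemma cint_ae f g : cmeasurable f -> cmeasurable g ->
  {ae m, forall t, f t = g t} -> cint f = cint g.
Proof.
move=> [f1 f2] [g1 g2] fg; congr Complex; apply: rint_ae => //.
  by apply: filterS fg => t ->.
by apply: filterS fg => t ->.
Qed.

Lemma cint_real (u : T -> R) : cint (fun t => (u t)%:C) = (rint m u)%:C.
Proof. by rewrite /cint/= rint0. Qed.

Definition csquare f := cmeasurable f /\ rintegrable m (fun t => cnorm2 (f t)).

Lemma csquare_parts f : csquare f ->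
  rintegrable m (fun t => complex.Re (f t) ^+ 2) /\
  rintegrable m (fun t => complex.Im (f t) ^+ 2).
Proof.
move=> [[f1 f2] fi]; split; apply: rintegrable_le fi.
- exact: measurable_funX.
- by move=> t; rewrite ger0_norm ?sqr_ge0// lerDl sqr_ge0.
- exact: measurable_funX.
- by move=> t; rewrite ger0_norm ?sqr_ge0// lerDr sqr_ge0.
Qed.

Lemma cintegrableM_square f g : csquare f -> csquare g -> cintegrable (fun t => f t * g t).
Proof.
move=> sf sg; have [f1 f2] := csquare_parts sf; have [g1 g2] := csquare_parts sg.
case: sf sg => [[mf1 mf2] _] [[mg1 mg2] _]; split.
  under eq_fun do rewrite ReM.
  by apply: rintegrableB; exact: rintegrableM_square.
under eq_fun do rewrite ImM.
by apply: rintegrableD; exact: rintegrableM_square.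
Qed.

Lemma csquareJ f : csquare f -> csquare (fun t => conjc (f t)).
Proof.
move=> [mf fi]; split; first exact: cmeasurableJ.
by under eq_fun do rewrite cnorm2J.
Qed.

Lemma csquareM_bounded f k (M : R) : csquare f -> cmeasurable k ->
  (forall t, cnorm2 (k t) <= M) -> csquare (fun t => f t * k t).
Proof.
move=> [mf fi] mk kM; split; first exact: cmeasurableM.
under eq_fun do rewrite cnorm2M.
apply: (@rintegrableM_bounded _ _ _ _ _ _ M) => //; first exact: measurable_cnorm2.
by move=> t; rewrite ger0_norm ?cnorm2_ge0.
Qed.

End ComplexIntegral.

Section ComplexLebesgue.
Variable R : realType.
Local Notation mu := (@lebesgue_measure R).
Implicit Types p q : R -> R[i].

Lemma cmeasurable_translation (a : R) p : cmeasurable p -> cmeasurable (fun t : R => p (t + a)).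
Proof.
by move=> [p1 p2]; split; [apply: (measurableT_comp p1)|apply: (measurableT_comp p2)];
  exact: measurable_addl.
Qed.

Lemma cintegrable_translation (a : R) p :
  cintegrable mu p -> cintegrable mu (fun t => p (t + a)).
Proof.
move=> [p1 p2]; split; first exact: (rintegrable_translation a p1).
exact: (rintegrable_translation a p2).
Qed.

Lemma csquare_translation (a : R) p : csquare mu p -> csquare mu (fun t => p (t + a)).
Proof.
move=> [mp ip]; split; first exact: cmeasurable_translation.
exact: (rintegrable_translation a ip).
Qed.

Lemma cint_translation (a : R) p : cintegrable mu p ->
  cint mu (fun t => p (t + a)) = cint mu p.
Proof.
move=> [p1 p2]; congr Complex; first exact: (rint_translation a p1).
exact: (rint_translation a p2).
Qed.

Lemma cint_fubini (h : R * R -> R[i]) : cintegrable (mu \x mu)%E h ->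
  [/\ {ae mu, forall x, cintegrable mu (fun y => h (x, y))},
      cintegrable mu (fun x => cint mu (fun y => h (x, y))),
      cintegrable mu (fun y => cint mu (fun x => h (x, y))) &
      cint mu (fun x => cint mu (fun y => h (x, y))) =
      cint mu (fun y => cint mu (fun x => h (x, y)))].
Proof.
move=> [h1 h2]; have [a0 a1 a2 a3] := rint_fubini h1; have [b0 b1 b2 b3] := rint_fubini h2.
split; [by apply: ae_imply2 a0 b0 => x|exact: conj a1 b1|exact: conj a2 b2|].
congr Complex; [exact: a3|exact: b3].
Qed.

Lemma cintegrable2_mul p q : cintegrable mu p -> cintegrable mu q ->
  cintegrable (mu \x mu)%E (fun z => p z.1 * q z.2).
Proof.
move=> [p1 p2] [q1 q2]; split.
  under eq_fun do rewrite ReM.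
  apply: rintegrableB; [exact: (rintegrable2_mul p1 q1)|exact: (rintegrable2_mul p2 q2)].
under eq_fun do rewrite ImM.
apply: rintegrableD; [exact: (rintegrable2_mul p1 q2)|exact: (rintegrable2_mul p2 q1)].
Qed.

Lemma cintegrable2_mul_translation p q : cintegrable mu p -> cintegrable mu q ->
  cintegrable (mu \x mu)%E (fun z => p (z.1 + z.2) * q z.2).
Proof.
move=> [p1 p2] [q1 q2]; split.
  under eq_fun do rewrite ReM.
  apply: rintegrableB; [exact: (rintegrable2_mul_translation p1 q1)|
                        exact: (rintegrable2_mul_translation p2 q2)].
under eq_fun do rewrite ImM.
apply: rintegrableD; [exact: (rintegrable2_mul_translation p1 q2)|
                      exact: (rintegrable2_mul_translation p2 q1)].
Qed.

End ComplexLebesgue.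

(** * Annihilation of sublevel sets *)

Section Threshold.
Variable R : realType.

Lemma bernoulli_add (h : R) n : 0 <= h -> 1 + h *+ n <= (1 + h) ^+ n.
Proof.
move=> h0; elim: n => [|n ih]; first by rewrite mulr0n addr0 expr0.
rewrite exprS mulrSr; apply: (le_trans _ (ler_wpM2l _ ih)); last by rewrite addr_ge0.
have : 0 <= h * (h *+ n) by rewrite mulr_ge0 ?mulrn_wge0.
by rewrite mulrDl !mulrDr !mul1r mulr1; lra.
Qed.

Lemma bernoulli_sub (y : R) n : 0 <= y <= 1 -> 1 - y *+ n <= (1 - y) ^+ n.
Proof.
move=> /andP[y0 y1]; elim: n => [|n ih]; first by rewrite mulr0n subr0 expr0.
rewrite exprS mulrSr; apply: (le_trans _ (ler_wpM2l _ ih)); last by rewrite subr_ge0.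
have : 0 <= y * (y *+ n) by rewrite mulr_ge0 ?mulrn_wge0.
by rewrite mulrBl !mulrBr !mul1r mulr1; lra.
Qed.

(** Write [r = s * s]: Bernoulli's inequality for [s^-1 = 1 + h] bounds [n s^n] by [h^-1], and the
    remaining factor [s^n] tends to 0. *)
Lemma cvg_natmul_geometric (r : R) : 0 <= r < 1 ->
  (fun n => n%:R * r ^+ n) @ \oo --> (0 : R).
Proof.
move=> /andP[r0 r1]; pose s := Num.sqrt r.
have s0 : 0 <= s by exact: sqrtr_ge0.
have rs : r = s * s by rewrite -expr2 sqr_sqrtr.
have s1 : s < 1.
  by rewrite ltNge; apply/negP => s1; move: r1; rewrite ltNge rs mulr_ege1.
have [se|sn] := eqVneq s 0.
  apply: cvg_near_cst; exists 1%N => // n /= n1.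
  by rewrite rs se mulr0 expr0n gtn_eqF// mulr0.
have sp : 0 < s by rewrite lt_def sn.
pose h := s^-1 - 1.
have h0 : 0 < h by rewrite subr_gt0 invf_gt1.
have b n : n%:R * s ^+ n <= h^-1.
  have := bernoulli_add n (ltW h0); rewrite subrKC exprVn => H.
  rewrite -(ler_pM2r h0) mulVf ?gt_eqF// mulrAC mulr_natl.
  rewrite -ler_pdivlMr ?exprn_gt0// div1r.
  by apply: le_trans H; rewrite lerDr.
apply: (@squeeze_cvgr _ _ _ _ (fun=> 0) (fun n => h^-1 * s ^+ n)).
- apply: nearW => n; rewrite mulr_ge0 ?exprn_ge0//=.
  by rewrite rs exprMn mulrA ler_wpM2r ?exprn_ge0.
- exact: cvg_cst.
- rewrite -[X in _ --> X](mulr0 h^-1); apply: cvgMr.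
  by apply: cvg_expr; rewrite ger0_norm.
Qed.

(** A polynomial familiar from elementary proofs of the Stone-Weierstrass theorem. The factor
    [2 ^ n] in the exponent places the jump at 1/2; the factor [n] makes the value at 1/2 itself
    tend to 0. *)
Definition threshold_poly_val (n : nat) (x : R) := (1 - x ^+ n) ^+ (n * 2 ^ n).

Lemma threshold_poly_val_bound n (x : R) : 0 <= x <= 1 ->
  0 <= threshold_poly_val n x <= 1.
Proof.
move=> /andP[x0 x1]; have y0 : 0 <= 1 - x ^+ n by rewrite subr_ge0 exprn_ile1.
have y1 : 1 - x ^+ n <= 1 by rewrite gerBl exprn_ge0.
by apply/andP; split; [exact: exprn_ge0|exact: exprn_ile1].
Qed.

(** With [y = x ^ n] and [N = n 2 ^ n], the product [N y] is [n (2 x) ^ n]. Below 1/2 it tends to 0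
    and [(1 - y) ^ N >= 1 - N y]. From 1/2 on it is at least [n], and [(1 - y) ^ N (1 + y) ^ N <= 1]
    gives the bound [1 / (1 + N y) <= 1 / (1 + n)]. *)
Lemma threshold_poly_val_cvg (x : R) : 0 <= x <= 1 ->
  (fun n => threshold_poly_val n x) @ \oo --> ((x < 2^-1)%R%:R : R).
Proof.
move=> /[dup] x01 /andP[x0 x1].
have [xl|xl] := ltP x 2^-1.
  apply: (@squeeze_cvgr _ _ _ _ (fun n => 1 - n%:R * (2 * x) ^+ n) (fun=> 1)).
  - apply: nearW => n; have /andP[_ ->] := threshold_poly_val_bound n x01; rewrite andbT.
    apply: le_trans (bernoulli_sub _ _); last by rewrite exprn_ge0//= exprn_ile1.
    by rewrite lerD2l lerN2 -[x ^+ n *+ _]mulr_natl natrM exprMn natrX mulrA.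
  - rewrite -[X in _ --> X](subr0 1); apply: cvgB; first exact: cvg_cst.
    by apply: cvg_natmul_geometric; rewrite mulr_ge0//=; lra.
  - exact: cvg_cst.
apply: (@squeeze_cvgr _ _ _ _ (fun=> 0) (fun n => harmonic n)).
- apply: nearW => n; have /andP[-> _] := threshold_poly_val_bound n x01; rewrite /harmonic/=.
  set y := x ^+ n; have y0 : 0 <= y by exact: exprn_ge0.
  have y1 : y <= 1 by exact: exprn_ile1.
  set N := (n * 2 ^ n)%N.
  have Ny : n%:R <= y *+ N.
    rewrite -[y *+ _]mulr_natl natrM -mulrA ler_peMr// /y natrX -exprMn exprn_ege1//.
    by lra.
  have N1 : 0 < 1 + y *+ N by rewrite ltr_wpDr// mulrn_wge0.
  apply: (@le_trans _ _ (1 + y *+ N)^-1).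
    rewrite -div1r ler_pdivlMr//.
    apply: (@le_trans _ _ ((1 - y) ^+ N * (1 + y) ^+ N)).
      by rewrite ler_wpM2l ?exprn_ge0 ?subr_ge0// bernoulli_add.
    rewrite -exprMn exprn_ile1//; last by nra.
    by rewrite mulr_ge0 ?subr_ge0 ?addr_ge0.
  by rewrite lef_pV2 ?posrE// -natr1 addrC lerD2l.
- exact: cvg_cst.
- exact: cvg_harmonic.
Qed.

Context d (T : measurableType d) (m : {measure set T -> \bar R}).

Section Annihilation.
Variables (u v : T -> R) (M : R).
Hypotheses (iu : rintegrable m u) (mv : measurable_fun setT v).
(** The bound is asked only where [u] does not vanish, so an unbounded [v] such as [(t - y) ^ 2] is
    allowed when [u] has bounded support. *)
Hypotheses (vM : forall t, u t != 0 -> `|v t| <= M).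
Hypothesis uv0 : forall j, rint m (fun t => u t * v t ^+ j) = 0.

Lemma rint_horner_eq0 (p : {poly R}) : rintegrable m (fun t => u t * p.[v t]) /\
  rint m (fun t => u t * p.[v t]) = 0.
Proof.
have mu := rintegrable_measurable iu.
have iuv j : rintegrable m (fun t => u t * v t ^+ j).
  apply: (@rintegrable_le _ _ _ _ _ (fun t => M ^+ j * `|u t|)).
  - by apply: measurable_funM => //; apply: measurable_funX.
  - move=> t; have [->|u0] := eqVneq (u t) 0; first by rewrite mul0r normr0 mulr0.
    by rewrite normrM mulrC ler_wpM2r// normrX lerXn2r ?nnegrE ?vM// (le_trans _ (vM u0)).
  - exact/rintegrableZ/rintegrable_norm.
suff E n : rintegrable m (fun t => u t * (\sum_(i < n) p`_i * v t ^+ i)) /\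
    rint m (fun t => u t * (\sum_(i < n) p`_i * v t ^+ i)) = 0.
  by have := E (size p); under eq_fun do rewrite -horner_coef.
elim: n => [|n [ih1 ih2]].
  by under eq_fun do rewrite big_ord0 mulr0; split; [exact: rintegrable0|exact: rint0].
under eq_fun do rewrite big_ord_recr/= mulrDr (mulrCA (u _)).
split; first exact/rintegrableD/rintegrableZ.
by rewrite rintD//; [rewrite ih2 rintZ// uv0 mulr0 addr0|exact: rintegrableZ].
Qed.

(* Polynomials in [v] annihilate [u]; an affine image [x] of [v] takes values in [0, 1], where
   [(1 - x ^ n) ^ (n 2 ^ n)] converges to the indicator of [x < 1/2]. *)
Lemma rint_threshold (tau : R) : rint m (fun t => u t * (v t < tau)%R%:R) = 0.
Proof.
(* Where [u] does not vanish, [L] exceeds twice the distance from [v] to [tau], which keeps [x]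
   within 1/2 of 1/2. The summand 1 makes [L] positive. *)
pose L := 2 * (`|M| + `|tau| + 1).
have L0 : 0 < L by rewrite mulr_gt0// ltr_wpDl// addr_ge0.
pose x t := 2^-1 + L^-1 * (v t - tau).
have x01 t : u t != 0 -> 0 <= x t <= 1.
  move=> u0; have := vM u0; have := ler_norm M; have := ler_norm tau; have := ler_norm (- tau).
  rewrite normrN ler_norml => h1 h2 h3 /andP[h4 h5].
  have xE : x t * L = L / 2 + (v t - tau).
    by rewrite /x; field; rewrite gt_eqF.
  by apply/andP; split; rewrite -(ler_pM2r L0) ?mul0r ?mul1r xE /L; lra.
have xlt t : (x t < 2^-1) = (v t < tau).
  by rewrite /x gtrDl pmulr_rlt0 ?invr_gt0// subr_lt0.
pose X' : {poly R} := (2^-1)%:P + L^-1%:P * ('X - tau%:P).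
pose Q n : {poly R} := (1 - X' ^+ n) ^+ (n * 2 ^ n).
have QE n t : (Q n).[v t] = threshold_poly_val n (x t).
  by rewrite /Q /X' /threshold_poly_val /x !(hornerE, horner_exp).
have cv : (fun n => rint m (fun t => u t * (Q n).[v t])) @ \oo -->
    rint m (fun t => u t * (v t < tau)%R%:R).
  have [|t||n t|//] := @rint_dominated_limit _ _ _ m (fun n t => u t * (Q n).[v t])
    (fun t => u t * (v t < tau)%R%:R) (fun t => `|u t|).
  - by move=> n; apply: rintegrable_measurable (rint_horner_eq0 (Q n)).1.
  - have [->|u0] := eqVneq (u t) 0.
      by under eq_fun do rewrite mul0r; rewrite mul0r; exact: cvg_cst.
    under eq_fun do rewrite QE.
    by apply: cvgMr; rewrite -xlt; exact/threshold_poly_val_cvg/x01.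
  - exact: rintegrable_norm.
  - have [->|u0] := eqVneq (u t) 0; first by rewrite mul0r normr0.
    rewrite normrM QE ler_piMr//.
    by have /andP[q0 q1] := threshold_poly_val_bound n (x01 _ u0); rewrite ger0_norm.
rewrite -(cvg_lim _ cv)//.
under eq_fun do rewrite (rint_horner_eq0 _).2.
exact: lim_cst.
Qed.

End Annihilation.

End Threshold.

(** * Uniqueness for Fourier transforms *)

Section Uniqueness.
Variable R : realType.
Local Notation mu := (@lebesgue_measure R).

Lemma ae_neq (a : R) : {ae mu, forall t, t != a}.
Proof.
exists [set a]; split => //; first exact: lebesgue_measure_set1.
by move=> t /= /negP; rewrite negbK => /eqP.
Qed.

Lemma in_ball (y r t : R) : (t \in (ball y r : set R)) = (`|t - y| < r).
Proof. by apply/idP/idP; rewrite inE -ball_normE /ball_/= distrC. Qed.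

(** Lebesgue differentiation along the balls of radius [harmonic n]: the averages around [y] are
    zero as soon as the radius is below [d0]. The threshold [d0] may depend on [y]. *)
Lemma ae_eq0_of_intervals (J : set R) (u : R -> R) : rintegrable mu u ->
  (forall y, J y -> exists2 d0 : R, 0 < d0 &
     forall d, 0 < d < d0 -> rint mu (fun t => u t * (`|t - y| < d)%R%:R) = 0) ->
  {ae mu, forall y, J y -> u y = 0}.
Proof.
move=> iu u0.
have locu : locally_integrable setT u.
  have := integrable_locally measurableT iu.
  by rewrite patch_setT.
pose E (x : R) n := ball x (harmonic n : R).
have hE x : nicely_shrinking x (E x).
  split; first by move=> n; exact: measurable_ball.
  have hp n : 0 < (harmonic n : R) by rewrite invr_gt0.
  exists (1, fun n => PosNum (hp n)); split => //=; [exact: cvg_harmonic|by move=> n|].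
  by move=> n; rewrite mul1e.
apply: ae_imply (lebesgue_differentiation locu) => y yleb Jy.
have := nice_lebesgue_differentiation hE locu yleb.
have [d0 d0p ud] := u0 _ Jy.
have vanish : \forall n \near \oo,
    ((mu (E y n))^-1 * \int[mu]_(t in E y n) (u t)%:E = 0)%E.
  have hh := @cvg_harmonic R; have /cvgrPdist_lt/(_ _ d0p) := hh.
  apply: filterS => n; rewrite sub0r normrN ger0_norm ?invr_ge0// => nd.
  rewrite [X in (_ * X)%E](_ : _ = 0%E) ?mule0//.
  have hp : 0 < (harmonic n : R) by rewrite invr_gt0.
  have := ud (harmonic n); rewrite hp nd => /(_ isT) H.
  have mb : measurable_fun setT (fun t : R => (`|t - y| < harmonic n)%R%:R : R).
    have -> : (fun t : R => (`|t - y| < harmonic n)%R%:R : R) = \1_(ball y (harmonic n)).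
      by apply/funext => t; rewrite indicE in_ball.
    by apply: measurable_indic; exact: measurable_ball.
  have iub : rintegrable mu (fun t => u t * (`|t - y| < harmonic n)%R%:R).
    apply: (rintegrableM_bounded (M := 1)) => // t.
    by case: (_ < _); rewrite ?normr1 ?normr0.
  have := rintE iub; rewrite H => e0; transitivity (0 : R)%:E => //; rewrite e0.
  rewrite [LHS]integral_mkcond; apply: eq_integral => t _.
  rewrite /patch /E in_ball; case: ifP => _; first by rewrite mulr1.
  by rewrite mulr0.
move=> cv; apply: EFin_inj; apply: cvg_unique cv _ => //.
exact: cvg_near_cst.
Qed.

(** The bound [2 * pi - d] keeps [x] off the neighbouring humps of the cosine, around [2 * pi] and
    [- (2 * pi)], so that the superlevel set is a single interval. *)
Lemma cos_lt_cos (d x : R) : 0 < d <= pi -> `|x| <= 2 * pi - d ->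
  (cos d < cos x) = (`|x| < d).
Proof.
move=> /andP[d0 dpi] xle; rewrite -(cos_norm x).
have x0 := normr_ge0 x; move: `|x| xle x0 => {}x xle x0.
have [xpi|xpi] := leP x pi.
  by rewrite ltr_cos// in_itv/= ?x0 ?xpi ?(ltW d0) ?dpi.
have -> : cos x = cos (2 * pi - x).
  by rewrite mulr_natl addrC cosD2pi cosN.
have p0 := @pi_gt0 R.
rewrite ltr_cos ?in_itv/=; try by apply/andP; split; lra.
by transitivity false; [apply/negbTE|apply/esym/negbTE]; rewrite -leNgt; lra.
Qed.

(** The exponent has the sign used in [STFT]. The Paley-Wiener function with spectrum [F] is
    therefore [ft F (- t)] on the real line, which explains the minus signs below. *)
Definition ft (p : R -> R[i]) (w : R) : R[i] :=
  cint mu (fun t => p t * expi (- (2 * pi * t * w))).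

Lemma ft_integrand (p : R -> R[i]) (w : R) : cintegrable mu p ->
  cintegrable mu (fun t => p t * expi (- (2 * pi * t * w))).
Proof.
move=> ip; apply: cintegrableM_expi => //; apply: measurable_funN.
by apply: measurable_funM => //; exact: measurable_funM.
Qed.

Lemma ftB (p q : R -> R[i]) (w : R) : cintegrable mu p -> cintegrable mu q ->
  ft (fun t => p t - q t) w = ft p w - ft q w.
Proof.
move=> ip iq; rewrite -cintB; try exact: ft_integrand.
by apply: cint_eq => t; rewrite mulrBl.
Qed.

Lemma ft_ae (p q : R -> R[i]) (w : R) : cmeasurable p -> cmeasurable q ->
  {ae mu, forall t, p t = q t} -> ft p w = ft q w.
Proof.
move=> mp mq pq.
have me : cmeasurable (fun t : R => expi (- (2 * pi * t * w))).
  apply: cmeasurable_expi; apply: measurable_funN.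
  by apply: measurable_funM => //; exact: measurable_funM.
apply: cint_ae; [exact: cmeasurableM|exact: cmeasurableM|].
by apply: ae_imply pq => t ->.
Qed.

Lemma ftJ (p : R -> R[i]) (w : R) : cintegrable mu p -> conjc (ft p w) = ft (fun t => conjc (p t)) (- w).
Proof.
move=> ip; rewrite -cintJ; last exact: ft_integrand.
by apply: cint_eq => t; rewrite conjcM -expiN mulrN !opprK.
Qed.

(** * Integrals against cosines with frequencies in [c Z] *)

Section Trigonometric.
Variables (h : R -> R[i]) (c : R).
Hypotheses (ih : cintegrable mu h) (h0 : forall n : int, ft h (n%:~R * c) = 0).

Let mcos (y : R) : measurable_fun setT (fun t : R => cos (2 * pi * c * (t - y))).
Proof.
apply: measurableT_comp; first by apply: continuous_measurable_fun; exact: continuous_cos.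
by apply: measurable_funM => //; exact: measurable_funB.
Qed.

Lemma cint_cos_pow_eq0 (y : R) j :
  cint mu (fun t => h t * (cos (2 * pi * c * (t - y)) ^+ j)%:C) = 0.
Proof.
pose e (n : int) (t : R) := expi (- (2 * pi * t * (n%:~R * c))).
pose C (t : R) := cos (2 * pi * c * (t - y)).
have ij k : cintegrable mu (fun t => h t * (C t ^+ k)%:C).
  apply: (cintegrableM_bounded (M := 1)) => //.
  - by split => //=; apply: measurable_funX; exact: mcos.
  - by move=> t /=; rewrite normrX exprn_ile1// cos_max.
  - by move=> t /=; rewrite normr0.
have ije k n : cintegrable mu (fun t => h t * (C t ^+ k)%:C * e n t).
  exact: (ft_integrand (n%:~R * c) (ij k)).
(* The induction on [j] needs the extra exponential [e n]: by Euler's formula each cosine factor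
   moves [n] to [n - 1] and [n + 1]. *)
suff H n : cint mu (fun t => h t * (C t ^+ j)%:C * e n t) = 0.
  rewrite -[RHS](H 0); apply: cint_eq => t.
  by rewrite /e mulr0z mul0r mulr0 oppr0 expi0 mulr1.
elim: j n => [|j ih' ] n.
  by rewrite -[RHS](h0 n); apply: cint_eq => t; rewrite expr0 mulr1.
pose A : R[i] := 2^-1%:C * expi (- (2 * pi * c * y)).
pose A' : R[i] := 2^-1%:C * expi (2 * pi * c * y).
have step t : h t * (C t ^+ j.+1)%:C * e n t =
    A * (h t * (C t ^+ j)%:C * e (n - 1) t) + A' * (h t * (C t ^+ j)%:C * e (n + 1) t).
  have e1 : expi (- (2 * pi * c * y)) * e (n - 1) t = expi (2 * pi * c * (t - y)) * e n t.
    by rewrite -!expiD rmorphB/=; congr expi; ring.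
  have e2 : expi (2 * pi * c * y) * e (n + 1) t = expi (- (2 * pi * c * (t - y))) * e n t.
    by rewrite -!expiD rmorphD/=; congr expi; ring.
  have e3 : (C t)%:C = 2^-1%:C * (expi (2 * pi * c * (t - y)) + expi (- (2 * pi * c * (t - y)))).
    by apply: complex_ext; rewrite !ReImE/= !(cosN, sinN) /C; field.
  transitivity (h t * (C t ^+ j)%:C * ((C t)%:C * e n t)).
    by rewrite exprSr rmorphM/= !mulrA.
  transitivity (h t * (C t ^+ j)%:C * (2^-1%:C *
      (expi (2 * pi * c * (t - y)) * e n t + expi (- (2 * pi * c * (t - y))) * e n t))).
    by rewrite e3 -mulrDl -!mulrA.
  by rewrite -e1 -e2 /A /A'; ring.
under cint_eq => t do rewrite step.
rewrite cintD; try exact: cintegrableZ.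
by rewrite !cintZ// !ih' !mulr0 addr0.
Qed.

(** [rint_threshold] yields sublevel sets, hence its use with the negative of the cosine. *)
Lemma rint_cos_threshold (y d : R) :
  rint mu (fun t => complex.Re (h t) * (cos (2 * pi * c * d) < cos (2 * pi * c * (t - y)))%R%:R) = 0
  /\
  rint mu (fun t => complex.Im (h t) * (cos (2 * pi * c * d) < cos (2 * pi * c * (t - y)))%R%:R) = 0.
Proof.
have key (u : R -> R) : rintegrable mu u ->
    (forall j, rint mu (fun t => u t * cos (2 * pi * c * (t - y)) ^+ j) = 0) ->
    rint mu (fun t => u t * (cos (2 * pi * c * d) < cos (2 * pi * c * (t - y)))%R%:R) = 0.
  move=> iu u0.
  have mv : measurable_fun setT (fun t : R => - cos (2 * pi * c * (t - y))).
    by apply: measurable_funN; exact: mcos.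
  have v1 t : u t != 0 -> `|- cos (2 * pi * c * (t - y))| <= 1.
    by move=> _; rewrite normrN cos_max.
  have v0 j : rint mu (fun t => u t * (- cos (2 * pi * c * (t - y))) ^+ j) = 0.
    under eq_fun do rewrite exprNn mulrCA.
    rewrite rintZ ?u0 ?mulr0//.
    apply: (rintegrableM_bounded (M := 1)) => //.
      by apply: measurable_funX; exact: mcos.
    by move=> t; rewrite normrX exprn_ile1// cos_max.
  rewrite -[RHS](rint_threshold iu mv v1 v0 (- cos (2 * pi * c * d))).
  by congr rint; apply/funext => t; rewrite ltrN2.
case: (ih) => ih1 ih2; split; apply: key => // j.
  transitivity (complex.Re (0 : R[i])); last by [].
  rewrite -(cint_cos_pow_eq0 y j); congr rint; apply/funext => t.
  by rewrite ReM/= mulr0 subr0.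
transitivity (complex.Im (0 : R[i])); last by [].
rewrite -(cint_cos_pow_eq0 y j); congr rint; apply/funext => t.
by rewrite ImM/= mulr0 add0r.
Qed.

End Trigonometric.

Lemma complex_ae_eq0 (h : R -> R[i]) : {ae mu, forall t, complex.Re (h t) = 0} ->
  {ae mu, forall t, complex.Im (h t) = 0} -> {ae mu, forall t, h t = 0}.
Proof.
by move=> h1 h2; apply: ae_imply2 h1 h2 => t e1 e2; apply: complex_ext; rewrite ?e1 ?e2.
Qed.

(** The cosine of period [k + 1] cuts out the interval of radius [d] around [y] together with its
    translates by multiples of the period. As [k] grows the translates leave every bounded set, and
    dominated convergence leaves the integral over the interval alone. *)
Lemma ft_unique (h : R -> R[i]) : cintegrable mu h -> (forall w, ft h w = 0) ->
  {ae mu, forall t, h t = 0}.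
Proof.
move=> ih h0.
have key (u : R -> R) : rintegrable mu u ->
    (forall y d k, rint mu (fun t => u t *
      (cos (2 * pi * k.+1%:R^-1 * d) < cos (2 * pi * k.+1%:R^-1 * (t - y)))%R%:R) = 0) ->
    {ae mu, forall t, u t = 0}.
  move=> iu u0.
  have : {ae mu, forall t, setT t -> u t = 0}; last by apply: ae_imply => t; exact.
  apply: ae_eq0_of_intervals => // y _; exists 1 => // d /andP[d0 _].
  pose F k t := u t *
    (cos (2 * pi * k.+1%:R^-1 * d) < cos (2 * pi * k.+1%:R^-1 * (t - y)))%R%:R.
  have cv : (fun k => rint mu (F k)) @ \oo --> rint mu (fun t => u t * (`|t - y| < d)%R%:R).
    have [|t||n t|//] := @rint_dominated_limit _ _ _ mu F
      (fun t => u t * (`|t - y| < d)%R%:R) (fun t => `|u t|).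
    - move=> k; apply: measurable_funM; first exact: (rintegrable_measurable iu).
      have mc : measurable_fun setT (fun t : R => cos (2 * pi * k.+1%:R^-1 * (t - y))).
        apply: measurableT_comp; first by apply: continuous_measurable_fun; exact: continuous_cos.
        by apply: measurable_funM => //; exact: measurable_funB.
      apply: (measurableT_comp (f := fun b : bool => b%:R : R)) => //.
      exact: measurable_fun_ltr.
    - apply: cvg_near_cst; near=> k; congr (_ * (nat_of_bool _)%:R).
      have k0 : 0 < k.+1%:R :> R by [].
      have kb : 2 * (d + `|t - y|) <= k.+1%:R.
        have kb : 2 * (d + `|t - y|) <= k%:R by near: k; exact: nbhs_infty_ger.
        by rewrite (le_trans kb)// ler_nat.
      have p0 := @pi_gt0 R; have n0 := normr_ge0 (t - y).
      have a0 : 0 < 2 * pi * k.+1%:R^-1 :> R by rewrite !mulr_gt0 ?invr_gt0.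
      have q0 : 0 < k.+1%:R^-1 :> R by rewrite invr_gt0.
      have qb : k.+1%:R^-1 * (2 * (d + `|t - y|)) <= 1.
        by rewrite mulrC ler_pdivrMr// mul1r.
      have nq : 0 <= k.+1%:R^-1 * `|t - y| by rewrite mulr_ge0// ltW.
      have dq : 0 < k.+1%:R^-1 * d by rewrite mulr_gt0.
      set q := k.+1%:R^-1 in a0 q0 qb nq dq *.
      rewrite cos_lt_cos.
      + by rewrite normrM (gtr0_norm a0) ltr_pM2l.
      + rewrite mulr_gt0//=; have : 0 <= pi * (1 - q * (2 * d)) by apply: mulr_ge0; lra.
        by move=> ?; lra.
      + rewrite normrM (gtr0_norm a0).
        have : 0 <= pi * (1 - q * (2 * (d + `|t - y|))) by apply: mulr_ge0; lra.
        by move=> ?; lra.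
    - exact: rintegrable_norm.
    - by rewrite normrM ler_piMr//; case: (_ < _); rewrite ?normr1 ?normr0.
  rewrite -(cvg_lim _ cv)//.
  by under eq_fun do rewrite u0; exact: lim_cst.
have [ih1 ih2] := ih.
by apply: complex_ae_eq0; apply: key => // y d k;
  have [] := @rint_cos_threshold h k.+1%:R^-1 ih (fun n => h0 _) y d.
Unshelve. all: by end_near. Qed.

(** For [|y| < B], [d < B - |y|] and [t] in the support, [|t - y| + d <= 2B <= 1 / c]: within the
    support, the periodic set meets only the interval around [y]. When [c = 1 / (2B)] the points [B]
    and [- B] coincide modulo the period; they are discarded as a null set. *)
Lemma ft_sampling_unique (B c : R) (h : R -> R[i]) : 0 < B -> 0 < c -> c <= (2 * B)^-1 ->
  cintegrable mu h -> (forall t, B < `|t| -> h t = 0) ->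
  (forall n : int, ft h (n%:~R * c) = 0) -> {ae mu, forall t, h t = 0}.
Proof.
move=> B0 c0 cB ih supp h0.
have cB' : c * (2 * B) <= 1 by rewrite -ler_pdivlMr ?div1r// mulr_gt0.
have p0 := @pi_gt0 R.
have key (u : R -> R) : rintegrable mu u -> (forall t, B < `|t| -> u t = 0) ->
    (forall y d, rint mu (fun t => u t *
      (cos (2 * pi * c * d) < cos (2 * pi * c * (t - y)))%R%:R) = 0) ->
    {ae mu, forall t, u t = 0}.
  move=> iu us u0.
  have : {ae mu, forall y, [set y | `|y| < B] y -> u y = 0}.
    apply: ae_eq0_of_intervals => // y /= yB; exists (B - `|y|); first by rewrite subr_gt0.
    move=> d /andP[d0 dB]; rewrite -[RHS](u0 y d); congr rint; apply/funext => t.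
    have [tB|/us ->] := leP `|t| B; last by rewrite !mul0r.
    have y0 := normr_ge0 y.
    have a0 : 0 < 2 * pi * c by rewrite !mulr_gt0.
    have nn := ler_normB t y.
    rewrite cos_lt_cos.
    - by rewrite normrM (gtr0_norm a0) ltr_pM2l.
    - rewrite mulr_gt0//=.
      have : c * (2 * d) <= 1 by apply: le_trans cB'; rewrite ler_pM2l//; lra.
      move=> ?; nra.
    - rewrite normrM (gtr0_norm a0).
      have : c * (`|t - y| + d) <= 1 by apply: le_trans cB'; rewrite ler_pM2l//; lra.
      by move=> ?; nra.
  move=> ae1; have b1 := ae_neq B; have b2 := ae_neq (- B).
  have b3 : {ae mu, forall t, (t != B) /\ (t != - B)} by apply: ae_imply2 b1 b2 => t.
  apply: ae_imply2 ae1 b3 => t H [t1 t2].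
  have [/H//|] := ltP `|t| B.
  rewrite le_eqVlt => /orP[|/us//]; rewrite eq_sym eqr_norml => /andP[/orP[] /eqP e _].
    by rewrite e eqxx in t1.
  by rewrite e eqxx in t2.
have [ih1 ih2] := ih.
apply: complex_ae_eq0; apply: key => //; try by move=> t /supp ->.
  by move=> y d; have [] := @rint_cos_threshold h c ih h0 y d.
by move=> y d; have [] := @rint_cos_threshold h c ih h0 y d.
Qed.

(** The powers of [(t - y) ^ 2] are polynomials in [t], hence annihilated, and its sublevel sets are
    the intervals centred at [y]. *)
Lemma moments_unique (B : R) (u : R -> R) : rintegrable mu u ->
  (forall t, B < `|t| -> u t = 0) ->
  (forall j, rint mu (fun t => u t * t ^+ j) = 0) -> {ae mu, forall t, u t = 0}.
Proof.
move=> iu us u0.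
have bd t : u t != 0 -> `|t| <= B by apply: contraNT; rewrite -ltNge => /us ->.
have : {ae mu, forall t, setT t -> u t = 0}; last by apply: ae_imply => t; exact.
apply: ae_eq0_of_intervals => // y _; exists 1 => // d /andP[d0 _].
have mv : measurable_fun setT (fun t : R => (t - y) ^+ 2).
  by apply: measurable_funX; exact: measurable_funB.
have v1 t : u t != 0 -> `|(t - y) ^+ 2| <= (B + `|y|) ^+ 2.
  move=> /bd tB; rewrite normrX lerXn2r ?nnegrE ?addr_ge0 ?(le_trans _ tB)//.
  by rewrite (le_trans (ler_normB _ _))// lerD2r.
have v0 j : rint mu (fun t => u t * ((t - y) ^+ 2) ^+ j) = 0.
  have [_ H] := @rint_horner_eq0 _ _ _ mu u id B iu (@measurable_id _ _ _) bd u0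
    (('X - y%:P) ^+ 2 ^+ j).
  rewrite -[RHS]H; congr rint; apply/funext => t.
  by rewrite !(hornerE, horner_exp).
rewrite -[RHS](rint_threshold iu mv v1 v0 (d ^+ 2)).
congr rint; apply/funext => t; congr (_ * (nat_of_bool _)%:R).
by rewrite -[in RHS](real_normK (num_real (t - y))) ltr_pXn2r ?nnegrE ?normr_ge0 ?(ltW d0).
Qed.

End Uniqueness.

(** * Continuity of translation *)

Section TranslationContinuity.
Variable R : realType.
Local Notation mu := (@lebesgue_measure R).

Lemma rintegrable_sqB (u v : R -> R) : measurable_fun setT u -> measurable_fun setT v ->
  rintegrable mu (fun t => u t ^+ 2) -> rintegrable mu (fun t => v t ^+ 2) ->
  rintegrable mu (fun t => (u t - v t) ^+ 2).
Proof.
move=> mu_ mv iu iv; apply: rintegrable_le (rintegrableZ 2 (rintegrableD iu iv)).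
  by apply: measurable_funX; exact: measurable_funB.
move=> t; rewrite ger0_norm ?sqr_ge0//; have := sqr_ge0 (u t + v t).
by rewrite sqrrD sqrrB; lra.
Qed.

Lemma rintegrable_indic_ball (K : R) : rintegrable mu (fun t => (`|t| <= K)%R%:R).
Proof.
have -> : (fun t : R => (`|t| <= K)%R%:R : R) = \1_(`[- K, K]%classic).
  by apply/funext => t; rewrite indicE mem_setE in_itv/= ler_norml.
exact: integrable_indic_itv.
Qed.

Lemma measurable_norm_le (K : R) (u : R -> R) : measurable_fun setT u ->
  measurable_fun setT (fun t : R => (`|u t| <= K)%R%:R : R).
Proof.
move=> mu_; apply: (measurableT_comp (f := fun b : bool => b%:R : R)) => //.
by apply: measurable_fun_ler => //; exact: measurableT_comp.
Qed.

Lemma square_density_truncation (v : R -> R) (eps : R) : measurable_fun setT v ->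
  rintegrable mu (fun t => v t ^+ 2) -> 0 < eps ->
  exists (K : R) (w : R -> R), [/\ 0 < K, measurable_fun setT w,
    forall t, `|w t| <= K /\ (K < `|t| -> w t = 0),
    rintegrable mu (fun t => (v t - w t) ^+ 2) &
    rint mu (fun t => (v t - w t) ^+ 2) <= eps].
Proof.
move=> mv iv e0.
pose w n t := v t * ((`|v t| <= n.+1%:R)%R%:R * (`|t| <= n.+1%:R)%R%:R).
have mw n : measurable_fun setT (w n).
  apply: measurable_funM => //; apply: measurable_funM; first exact: measurable_norm_le.
  exact: (measurable_norm_le _ (@measurable_id _ _ _)).
have b n t : `|(v t - w n t) ^+ 2| <= v t ^+ 2.
  rewrite ger0_norm ?sqr_ge0// /w.
  by case: (leP `|v t| _) => _; case: (leP `|t| _) => _;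
    rewrite ?(mulr0, mul0r, mulr1, subr0)// subrr expr0n sqr_ge0.
have mdiff n : measurable_fun setT (fun t : R => (v t - w n t) ^+ 2).
  by apply: measurable_funX; exact: measurable_funB.
have pt t : (fun n => (v t - w n t) ^+ 2) @ \oo --> (0 : R).
  apply: cvg_near_cst; near=> n.
  have h1 : `|v t| <= n.+1%:R.
    have h : `|v t| <= n%:R by near: n; exact: nbhs_infty_ger.
    by rewrite (le_trans h)// ler_nat.
  have h2 : `|t| <= n.+1%:R.
    have h : `|t| <= n%:R by near: n; exact: nbhs_infty_ger.
    by rewrite (le_trans h)// ler_nat.
  by rewrite /w h1 h2 !mulr1 subrr expr0n.
have [_ _ cv] := @rint_dominated_limit _ _ _ mu _ _ _ mdiff pt iv b.
rewrite rint0 in cv.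
have /cvgrPdist_lt/(_ _ e0) [N _ /(_ N (leqnn N))] := cv.
rewrite /= sub0r normrN => H.
exists N.+1%:R, (w N); split => //.
- move=> t; rewrite /w; split.
    case: (leP `|v t|) => vt; last by rewrite mul0r mulr0 normr0.
    by case: (leP `|t| _) => _; rewrite ?(mulr0, mulr1) ?normr0.
  by rewrite ltNge => /negbTE ->; rewrite !mulr0.
- by apply: rintegrable_le iv; [exact: mdiff|exact: b].
- exact/ltW/(le_lt_trans (ler_norm _) H).
Unshelve. all: by end_near. Qed.

(** Continuous approximation is available in [L^1] on a bounded interval. After truncation
    [|v'| <= K], so clipping the approximant to [[- K, K]] brings it no farther from [v']; the ramp
    [phi] takes it down to 0 between [K] and [K + 1], where [v'] is zero. Both functions being
    bounded by [K], the squared error is at most [2 K] times the [L^1] error. *)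
Lemma square_density_continuous (v : R -> R) (eps : R) : measurable_fun setT v ->
  rintegrable mu (fun t => v t ^+ 2) -> 0 < eps ->
  exists (K : R) (w : R -> R), [/\ continuous w,
    forall t, `|w t| <= K /\ (K < `|t| -> w t = 0),
    rintegrable mu (fun t => (v t - w t) ^+ 2) &
    rint mu (fun t => (v t - w t) ^+ 2) <= eps].
Proof.
move=> mv iv e0.
have e4 : 0 < eps / 4 by rewrite divr_gt0.
have [K [v' [K0 mv' v'K iv' v'e]]] := square_density_truncation mv iv e4.
pose E : set R := `[- (K + 1), K + 1]%classic.
have mE : measurable E by exact: measurable_itv.
have fE : (mu E < +oo)%E.
  by rewrite lebesgue_measure_itv/=; case: ifP => _; rewrite ?ltry.
have iE : mu.-integrable E (EFin \o v').
  apply: measurable_bounded_integrable => //; first exact: measurable_funS mv'.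
  exists K; split; first exact: num_real.
  by move=> M KM t _; exact: (le_trans (v'K t).1 (ltW KM)).
have [g [gc gi]] := approximation_continuous_integrable mE fE iE.
pose G n t := `|v' t - g n t| * (`|t| <= K + 1)%R%:R.
have iG n : rintegrable mu (G n).
  have h0 : mu.-integrable E (EFin \o (fun t => v' t - g n t)).
    by have := @integrableB _ _ _ mu E mE _ _ iE (gi n).
  have h1 : mu.-integrable E (EFin \o (fun t => `|v' t - g n t|)).
    exact: integrable_norm h0.
  have h2 := (@integrable_mkcond _ _ _ mu E _ mE).1 h1.
  apply: eq_integrable h2 => // t _; rewrite /patch /G /E mem_setE in_itv/= -ler_norml.
  by case: ifP => _; rewrite /= ?mulr1 ?mulr0.
have GE n : (\int[mu]_(z in E) `|(v' z - g n z)%:E| = (rint mu (G n))%:E)%E.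
  rewrite rintE// [LHS]integral_mkcond; apply: eq_integral => t _.
  rewrite /patch /G /E mem_setE in_itv/= -ler_norml.
  by case: ifP => _; rewrite /= ?mulr1 ?mulr0.
under eq_fun do rewrite GE.
move=> /fine_cvg /= cvG.
(* The factor [2 * K] pays for the passage from [L^1] to squares. Two errors of [eps / 4], each
   doubled by [(a + b)^2 <= 2 a^2 + 2 b^2], add up to [eps]. *)
have e8 : 0 < eps / 4 / (2 * K) by rewrite divr_gt0// mulr_gt0.
have /cvgrPdist_lt/(_ _ e8) [N _ /(_ N (leqnn N))] := cvG.
rewrite /= sub0r normrN => /(le_lt_trans (ler_norm _)) H.
pose cl (t : R) : R := Num.max (- K) (Num.min K (g N t)).
pose phi (t : R) : R := Num.max 0 (Num.min 1 (K + 1 - `|t|)).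
pose w (t : R) : R := cl t * phi t.
have wc : continuous w.
  move=> t; apply: cvgM.
    apply: (@continuous_max R _ (fun=> - K) (fun s => Num.min K (g N s)) t); first exact: cvg_cst.
    by apply: (@continuous_min R _ (fun=> K) (g N) t); [exact: cvg_cst|exact: gc].
  apply: (@continuous_max R _ (fun=> 0) (fun s => Num.min 1 (K + 1 - `|s|)) t); first exact: cvg_cst.
  apply: (@continuous_min R _ (fun=> 1) (fun s => K + 1 - `|s|) t); first exact: cvg_cst.
  by apply: cvgB; [exact: cvg_cst|exact: cvg_norm].
have mw : measurable_fun setT w by exact: continuous_measurable_fun.
have clK t : `|cl t| <= K.
  by rewrite ler_norml /cl le_max lexx/= ge_max ge_min lexx/= andbT; lra.
have phi01 t : 0 <= phi t <= 1.
  by rewrite /phi le_max lexx/= ge_max ge_min lexx/= ler01.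
have phi0 t : K + 1 < `|t| -> phi t = 0.
  by move=> tK; apply/max_idPl; rewrite ge_min; apply/orP; right; lra.
have phi1 t : `|t| <= K -> phi t = 1.
  move=> tK; rewrite /phi; have -> : Num.min 1 (K + 1 - `|t|) = 1.
    by apply/min_idPl; lra.
  by apply/max_idPr.
have v'cl t : `|v' t - cl t| <= `|v' t - g N t|.
  have := (v'K t).1; rewrite /cl ler_norml => /andP[h1 h2].
  have NK : - K <= K by lra.
  rewrite minEle; case: ifP => [h3|/negP h3]; rewrite maxEle.
    have {}h3 : K <= g N t := h3.
    case: ifP => [_|/negP[]]; last exact: NK.
    by rewrite !ler0_norm; lra.
  have {}h3 : g N t < K by rewrite ltNge; apply/negP.
  case: ifP => [//|/negP h4].
  have {}h4 : g N t < - K by rewrite ltNge; apply/negP.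
  by rewrite !ger0_norm; lra.
have wb t : (v' t - w t) ^+ 2 <= 2 * K * G N t.
  have v't := (v'K t).1; have clt := clK t.
  have wt : `|w t| <= K.
    rewrite /w normrM; have /andP[f0 f1] := phi01 t; rewrite (ger0_norm f0).
    by rewrite (le_trans _ clt)// ler_piMr.
  have d2 : `|v' t - w t| <= 2 * K by rewrite (le_trans (ler_normB _ _))//; lra.
  have dG : `|v' t - w t| <= G N t.
    rewrite /G; case: (leP `|t| (K + 1)) => tK1; last first.
      by rewrite (v'K t).2 ?(lt_trans _ tK1) ?ltrDl// /w phi0// mulr0 subrr normr0 mulr0.
    rewrite mulr1 (le_trans _ (v'cl t))//.
    have [tK|tK] := leP `|t| K; first by rewrite /w phi1// mulr1.
    rewrite (v'K t).2// !sub0r !normrN /w normrM; have /andP[f0 f1] := phi01 t.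
    by rewrite (ger0_norm f0) ler_piMr.
  rewrite -(real_normK (num_real (_ - _))) expr2.
  by apply: ler_pM.
have ivw : rintegrable mu (fun t => (v' t - w t) ^+ 2).
  apply: rintegrable_le (rintegrableZ (2 * K) (iG N)).
    by apply: measurable_funX; exact: measurable_funB.
  by move=> t; rewrite ger0_norm ?sqr_ge0.
have bd t : (v t - w t) ^+ 2 <= 2 * (v t - v' t) ^+ 2 + 2 * (v' t - w t) ^+ 2.
  have := sqr_ge0 ((v t - v' t) - (v' t - w t)); nra.
have isum : rintegrable mu (fun t => 2 * (v t - v' t) ^+ 2 + 2 * (v' t - w t) ^+ 2).
  by apply: rintegrableD; exact: rintegrableZ.
have ivW : rintegrable mu (fun t => (v t - w t) ^+ 2).
  apply: rintegrable_le isum; first by apply: measurable_funX; exact: measurable_funB.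
  by move=> t; rewrite ger0_norm ?sqr_ge0.
exists (K + 1), w; split => //.
  move=> t; split; last by move=> /phi0; rewrite /w => ->; rewrite mulr0.
  rewrite /w normrM; have /andP[f0 f1] := phi01 t; rewrite (ger0_norm f0).
  by rewrite (@le_trans _ _ `|cl t|) ?ler_piMr// (le_trans (clK t))// lerDl.
apply: le_trans (rint_le ivW isum bd) _.
rewrite rintD; try exact: rintegrableZ.
rewrite !rintZ//.
have : rint mu (fun t => (v' t - w t) ^+ 2) <= eps / 4.
  apply: le_trans (rint_le ivw (rintegrableZ (2 * K) (iG N)) wb) _.
  by rewrite rintZ// mulrC -ler_pdivlMr ?mulr_gt0// ltW.
lra.
Qed.

(** A weighted inequality between arithmetic and geometric means does the work of Cauchy-Schwarz
    without square roots; the weight [l] is chosen by the caller. *)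
Lemma rint_pair_bound (u v : R -> R) (l : R) : measurable_fun setT u -> measurable_fun setT v ->
  rintegrable mu (fun t => u t ^+ 2) -> rintegrable mu (fun t => v t ^+ 2) -> 0 < l ->
  `|rint mu (fun t => u t * v t)| <=
  l * rint mu (fun t => u t ^+ 2) + l^-1 * rint mu (fun t => v t ^+ 2).
Proof.
move=> mu_ mv iu iv l0.
have iuv := @rintegrableM_square _ _ _ mu _ _ mu_ mv iu iv.
apply: le_trans (norm_rint iuv) _; rewrite -!rintZ// -rintD; try exact: rintegrableZ.
apply: rint_le; first exact: rintegrable_norm.
  by apply: rintegrableD; exact: rintegrableZ.
move=> t; rewrite normrM -(real_normK (num_real (u t))) -(real_normK (num_real (v t))).
set a := `|u t|; set b := `|v t|.
have a0 : 0 <= a by exact: normr_ge0.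
have b0 : 0 <= b by exact: normr_ge0.
have : 0 <= l * (a - l^-1 * b) ^+ 2 by rewrite mulr_ge0 ?sqr_ge0// ltW.
have -> : l * (a - l^-1 * b) ^+ 2 = l * a ^+ 2 + l^-1 * b ^+ 2 - 2 * (a * b).
  by field; rewrite gt_eqF.
have : 0 <= a * b by rewrite mulr_ge0.
lra.
Qed.

(** Replacing [v] by a continuous [w] of bounded support costs an error uniform in the shift, since
    translation preserves the norm of [u]. Moving the shift from [u] onto [w] then leaves a
    pointwise limit under a dominating function. *)
Lemma rint_translation_cvg (u v : R -> R) (s_ : nat -> R) (s : R) :
  measurable_fun setT u -> measurable_fun setT v ->
  rintegrable mu (fun t => u t ^+ 2) -> rintegrable mu (fun t => v t ^+ 2) ->
  s_ @ \oo --> s ->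
  (fun n => rint mu (fun t => u (s_ n + t) * v t)) @ \oo --> rint mu (fun t => u (s + t) * v t).
Proof.
move=> mu_ mv iu iv ss.
have mus a : measurable_fun setT (fun t : R => u (a + t)).
  by apply: measurableT_comp => //; exact: measurable_funD.
have ius a : rintegrable mu (fun t => u (a + t) ^+ 2).
  by under eq_fun do rewrite addrC; exact: (rintegrable_translation a iu).
have eus a : rint mu (fun t => u (a + t) ^+ 2) = rint mu (fun t => u t ^+ 2).
  by under eq_fun do rewrite addrC; exact: (rint_translation a iu).
have ip a (w : R -> R) : measurable_fun setT w -> rintegrable mu (fun t => w t ^+ 2) ->
    rintegrable mu (fun t => u (a + t) * w t).
  by move=> mw iw; exact: (@rintegrableM_square _ _ _ mu _ _ (mus a) mw (ius a) iw).
pose A := rint mu (fun t => u t ^+ 2).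
have A0 : 0 <= A by apply: rint_ge0 => t; exact: sqr_ge0.
apply/cvgrPdist_lt => e e0.
(* With weight [l] and squared error at most [l * l], the bound of [rint_pair_bound] is
   [l A + l = e / 4]. *)
pose l := e / (4 * (A + 1)).
have A1 : 0 < A + 1 by rewrite ltr_wpDl.
have l0 : 0 < l by rewrite divr_gt0// mulr_gt0.
have [K [w [wc wK ivw vwl]]] := square_density_continuous mv iv (mulr_gt0 l0 l0).
have mw : measurable_fun setT w by exact: continuous_measurable_fun.
have mvw : measurable_fun setT (fun t => v t - w t) by exact: measurable_funB.
have iw : rintegrable mu (fun t => w t ^+ 2).
  by have := rintegrable_sqB mv mvw iv ivw; under eq_fun do rewrite subKr.
have est a : `|rint mu (fun t => u (a + t) * v t) - rint mu (fun t => u (a + t) * w t)| <= e / 4.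
  rewrite -rintB; [|exact: ip|exact: ip].
  under eq_fun do rewrite -mulrBr.
  apply: le_trans (rint_pair_bound (mus a) mvw (ius a) ivw l0) _.
  rewrite eus -/A.
  have : l^-1 * rint mu (fun t => (v t - w t) ^+ 2) <= l.
    by rewrite mulrC ler_pdivrMr.
  have : l * (A + 1) = e / 4 by rewrite /l; field; rewrite gt_eqF.
  by rewrite mulrDr mulr1; lra.
have shift a : rint mu (fun t => u (a + t) * w t) = rint mu (fun t => u t * w (t - a)).
  have iuw : rintegrable mu (fun t => u (a + t) * w t) by exact: ip.
  rewrite -(rint_translation (- a) iuw); congr rint; apply/funext => t.
  by rewrite addrC subrK.
have [M sM] : exists M, forall n, `|s_ n| <= M.
  have [M [_ HM]] := cvg_seq_bounded (cvgP _ ss).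
  by exists (M + 1) => n; apply: (HM (M + 1)) => //; rewrite ltrDl.
have cvw : (fun n => rint mu (fun t => u (s_ n + t) * w t)) @ \oo -->
    rint mu (fun t => u (s + t) * w t).
  rewrite shift; under eq_fun do rewrite shift.
  have mws a : measurable_fun setT (fun t : R => w (t - a)).
    by apply: measurableT_comp => //; exact: measurable_funB.
  have pt t : (fun n => u t * w (t - s_ n)) @ \oo --> u t * w (t - s).
    have ts : (fun n => t - s_ n) @ \oo --> t - s by apply: cvgB => //; exact: cvg_cst.
    by apply: cvgMr; have := cvg_comp _ _ ts (wc (t - s)).
  (* The shifts are bounded by [M], so every translate of [w] lives on [|t| <= K + M], where
     [|u| <= u ^ 2 + 1]. *)
  have ib : rintegrable mu (fun t => `|K| * (u t ^+ 2 + (`|t| <= K + M)%R%:R)).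
    exact/rintegrableZ/rintegrableD/rintegrable_indic_ball.
  have b n t : `|u t * w (t - s_ n)| <= `|K| * (u t ^+ 2 + (`|t| <= K + M)%R%:R).
    rewrite normrM mulrC.
    have [wb w0] := wK (t - s_ n).
    have [tK|tK] := leP `|t| (K + M); last first.
      rewrite w0; first by rewrite normr0 mul0r mulr_ge0// addr_ge0 ?sqr_ge0.
      have := ler_normB t (s_ n); have := sM n; have := ler_normD (t - s_ n) (s_ n).
      by rewrite subrK; lra.
    rewrite ler_pM// ?(le_trans wb) ?ler_norm//.
    rewrite -(real_normK (num_real (u t))) /=.
    by have := sqr_ge0 (`|u t| - 1); have := normr_ge0 (u t); rewrite sqrrB1; lra.
  by have [_ _ cv] := @rint_dominated_limit _ _ _ mu _ _ _
    (fun n => measurable_funM mu_ (mws (s_ n))) pt ib b.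
have e4 : 0 < e / 4 by rewrite divr_gt0.
move: cvw => /cvgrPdist_lt/(_ _ e4); apply: filterS => n H.
have h1 := est (s_ n); have h2 := est s.
move: H h1 h2.
set a := rint _ _; set b := rint _ _; set c := rint _ _; set d := rint _ _.
by rewrite !ltr_norml !ler_norml => /andP[? ?] /andP[? ?] /andP[? ?]; apply/andP; split; lra.
Qed.

(** A ball has positive measure, so none is contained in the null set where [P] may fail. *)
Lemma ae_approach (P : R -> Prop) (s : R) : {ae mu, forall t, P t} ->
  exists s_ : nat -> R, s_ @ \oo --> s /\ forall n, P (s_ n).
Proof.
move=> [N [mN N0 PN]].
have near_s n : exists t, `|s - t| < (harmonic n : R) /\ P t.
  apply: contrapT => /forallNP H.
  have hp : 0 < (harmonic n : R) by rewrite invr_gt0.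
  have sub : ball s (harmonic n) `<=` N.
    move=> t; rewrite -ball_normE /ball_/= => st; apply: PN => /= Pt.
    by apply: (H t); split.
  have : (mu (ball s (harmonic n)) <= mu N)%E.
    by apply: le_measure => //; rewrite inE//; exact: measurable_ball.
  have -> : mu N = 0%E by exact: N0.
  by rewrite lebesgue_measure_ball ?(ltW hp)// lee_fin leNgt mulrn_wgt0.
have [s_ Hs] := choice near_s.
exists s_; split; last by move=> n; have [] := Hs n.
apply/cvgrPdist_lt => e e0.
have hh := @cvg_harmonic R; have /cvgrPdist_lt/(_ _ e0) := hh.
apply: filterS => n; rewrite sub0r normrN ger0_norm ?invr_ge0// => H.
by have [h _] := Hs n; exact: lt_trans h H.
Qed.

End TranslationContinuity.

(** * Correlations *)

Section Correlation.
Variable R : realType.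
Local Notation mu := (@lebesgue_measure R).
Implicit Types p q D psi : R -> R[i].

(** The convolution of [p] with the reflection of [q]. No conjugate is built in; autocorrelations
    pass it explicitly as [q]. *)
Definition corr p q (s : R) : R[i] := cint mu (fun e => p (s + e) * q e).

Lemma corr_integrable p q : cintegrable mu p -> cintegrable mu q -> cintegrable mu (corr p q).
Proof. by move=> ip iq; have [] := cint_fubini (cintegrable2_mul_translation ip iq). Qed.

Lemma ft_corr p q (w : R) : cintegrable mu p -> cintegrable mu q ->
  ft (corr p q) w = ft p w * ft q (- w).
Proof.
move=> ip iq; have I2 := cintegrable2_mul_translation ip iq.
have mE : measurable_fun setT (fun z : R * R => - (2 * pi * z.1 * w)).
  by apply: measurable_funN; apply: measurable_funM => //; exact: measurable_funM.
have I3 := cintegrableM_expi I2 mE.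
have [ae1 F1 _ _] := cint_fubini I2; have [_ G1 _ eq] := cint_fubini I3.
transitivity (cint mu (fun s => cint mu (fun e => p (s + e) * q e * expi (- (2 * pi * s * w))))).
  apply: cint_ae; [|exact: cintegrable_measurable G1|].
    exact: (cintegrable_measurable (ft_integrand w F1)).
  apply: ae_imply ae1 => s hs; rewrite mulrC -(cintZ _ hs).
  by apply: cint_eq => e; rewrite mulrC.
rewrite eq -cintZ; last exact: ft_integrand.
apply: cint_eq => e.
have ipe : cintegrable mu (fun s => p (s + e) * expi (- (2 * pi * (s + e) * w))).
  exact: (cintegrable_translation e (ft_integrand w ip)).
have -> : (fun s => p (s + e) * q e * expi (- (2 * pi * s * w))) =
    (fun s => (q e * expi (2 * pi * e * w)) * (p (s + e) * expi (- (2 * pi * (s + e) * w)))).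
  apply/funext => s.
  have -> : expi (- (2 * pi * s * w)) = expi (2 * pi * e * w) * expi (- (2 * pi * (s + e) * w)).
    by rewrite -expiD; congr expi; ring.
  by ring.
rewrite (cintZ _ ipe) (cint_translation e (ft_integrand w ip)) mulrC.
by rewrite mulrN opprK.
Qed.

Lemma corr_cvg p q (s_ : nat -> R) (s : R) : csquare mu p -> csquare mu q -> s_ @ \oo --> s ->
  (fun n => complex.Re (corr p q (s_ n))) @ \oo --> complex.Re (corr p q s) /\
  (fun n => complex.Im (corr p q (s_ n))) @ \oo --> complex.Im (corr p q s).
Proof.
move=> sp sq ss.
have [p1 p2] := csquare_parts sp; have [q1 q2] := csquare_parts sq.
have [[mp1 mp2] _] := sp; have [[mq1 mq2] _] := sq.
have i2 (u v : R -> R) a : measurable_fun setT u -> measurable_fun setT v ->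
    rintegrable mu (fun t => u t ^+ 2) -> rintegrable mu (fun t => v t ^+ 2) ->
    rintegrable mu (fun t => u (a + t) * v t).
  move=> mu_ mv iu iv; apply: (@rintegrableM_square _ _ _ mu (fun t => u (a + t))) => //.
    by apply: measurableT_comp => //; exact: measurable_funD.
  by under eq_fun do rewrite addrC; exact: (rintegrable_translation a iu).
split.
  have E a : complex.Re (corr p q a) =
      rint mu (fun t => complex.Re (p (a + t)) * complex.Re (q t)) -
      rint mu (fun t => complex.Im (p (a + t)) * complex.Im (q t)).
    rewrite -rintB; [|exact: (i2 _ _ a mp1 mq1 p1 q1)|exact: (i2 _ _ a mp2 mq2 p2 q2)].
    by congr rint; apply/funext => t; rewrite ReM.
  rewrite E; under eq_fun do rewrite E.
  by apply: cvgB; [exact: (rint_translation_cvg mp1 mq1 p1 q1 ss)|exact: (rint_translation_cvg mp2 mq2 p2 q2 ss)].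
have E a : complex.Im (corr p q a) =
    rint mu (fun t => complex.Re (p (a + t)) * complex.Im (q t)) +
    rint mu (fun t => complex.Im (p (a + t)) * complex.Re (q t)).
  rewrite -rintD; [|exact: (i2 _ _ a mp1 mq2 p1 q2)|exact: (i2 _ _ a mp2 mq1 p2 q1)].
  by congr rint; apply/funext => t; rewrite ImM.
rewrite E; under eq_fun do rewrite E.
by apply: cvgD; [exact: (rint_translation_cvg mp1 mq2 p1 q2 ss)|exact: (rint_translation_cvg mp2 mq1 p2 q1 ss)].
Qed.

Lemma corr_eq_of_ae p q p' q' : csquare mu p -> csquare mu q -> csquare mu p' -> csquare mu q' ->
  {ae mu, forall s, corr p q s = corr p' q' s} -> forall s, corr p q s = corr p' q' s.
Proof.
move=> sp sq sp' sq' ae s.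
have [s_ [ss sE]] := ae_approach s ae.
have [r1 i1] := corr_cvg sp sq ss; have [r2 i2] := corr_cvg sp' sq' ss.
apply: complex_ext.
  apply: (cvg_unique _ r1) => //; move: r2; apply: cvg_trans.
  by apply: near_eq_cvg; apply: nearW => n; rewrite sE.
apply: (cvg_unique _ i1) => //; move: i2; apply: cvg_trans.
by apply: near_eq_cvg; apply: nearW => n; rewrite sE.
Qed.

(** Integrability gives the Fourier transform of the correlation, [|ft p|^2]; square integrability
    gives the continuity in [s] that removes the exceptional null set. *)
Lemma autocorrelation_eq p q : cintegrable mu p -> csquare mu p ->
  cintegrable mu q -> csquare mu q ->
  (forall w, cnorm2 (ft p w) = cnorm2 (ft q w)) ->
  forall s, corr p (fun t => conjc (p t)) s = corr q (fun t => conjc (q t)) s.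
Proof.
move=> ip sp iq sq pq; apply: corr_eq_of_ae => //; try exact: csquareJ.
have icp := corr_integrable ip (cintegrableJ ip).
have icq := corr_integrable iq (cintegrableJ iq).
have := ft_unique (cintegrableB icp icq).
move=> H; apply: ae_imply (H _) => [t /eqP|w]; first by rewrite subr_eq0 => /eqP.
rewrite ftB// !ft_corr//; try exact: cintegrableJ.
by rewrite -!ftJ// !mulcJ pq subrr.
Qed.

Lemma ft_pairing D psi (x : R) : cintegrable mu D -> cintegrable mu psi ->
  cintegrable mu (fun w => D w * ft psi (- w)) /\
  cint mu (fun e => ft D (- e) * psi (e - x)) = ft (fun w => D w * ft psi (- w)) (- x).
Proof.
move=> iD ips.
(* Used twice: [y = 0] removes the exponential and gives the integrability, [y = x] gives the
   formula. *)
have fub y : cintegrable mu (fun w => D w * ft psi (- w) * expi (- (2 * pi * w * - y))) /\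
    cint mu (fun e => ft D (- e) * psi (e - y)) =
    cint mu (fun w => D w * ft psi (- w) * expi (- (2 * pi * w * - y))).
  have ipy := cintegrable_translation (- y) ips.
  have mE : measurable_fun setT (fun z : R * R => - (2 * pi * z.2 * - z.1)).
    apply: measurable_funN; apply: measurable_funM; last exact: measurable_funN.
    exact: measurable_funM.
  have [_ _ G1 eq] := cint_fubini (cintegrableM_expi (cintegrable2_mul ipy iD) mE).
  have inner w : cint mu (fun e => psi (e - y) * D w * expi (- (2 * pi * w * - e))) =
      D w * ft psi (- w) * expi (- (2 * pi * w * - y)).
    have ipt := cintegrable_translation (- y) (ft_integrand (- w) ips).
    transitivity (cint mu (fun e => (D w * expi (- (2 * pi * w * - y))) *
        (psi (e - y) * expi (- (2 * pi * (e - y) * - w))))).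
      apply: cint_eq => e.
      have -> : expi (- (2 * pi * w * - e)) =
          expi (- (2 * pi * w * - y)) * expi (- (2 * pi * (e - y) * - w)).
        by rewrite -expiD; congr expi; ring.
      by ring.
    by rewrite (cintZ _ ipt) (cint_translation (- y) (ft_integrand (- w) ips)) mulrAC.
  split; first by apply: cintegrable_eq G1 => w; exact: inner.
  transitivity (cint mu (fun e => cint mu (fun w => psi (e - y) * D w * expi (- (2 * pi * w * - e))))).
    apply: cint_eq => e; rewrite mulrC -cintZ; last exact: ft_integrand.
    by apply: cint_eq => w; rewrite mulrA.
  by rewrite eq; apply: cint_eq => w; exact: inner.
have [i0 _] := fub 0; have [_ e] := fub x; split => //.
by apply: cintegrable_eq i0 => w; rewrite oppr0 mulr0 oppr0 expi0 mulr1.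
Qed.

Lemma pairing_eq0 D psi : cintegrable mu D -> cintegrable mu psi ->
  (forall x, cint mu (fun e => ft D (- e) * psi (e - x)) = 0) ->
  {ae mu, forall w, D w * ft psi (- w) = 0}.
Proof.
move=> iD ips H; have [iDp _] := ft_pairing 0 iD ips.
apply: ft_unique iDp _ => w.
by have [_] := ft_pairing (- w) iD ips; rewrite H opprK.
Qed.

End Correlation.

(** * Zeros of band-limited functions *)

Section Zeros.
Variable R : realType.
Local Notation mu := (@lebesgue_measure R).

Lemma is_derive_trig (a b k w : R) : is_derive w 1
  (fun x : R => a * cos (k * x) + b * sin (k * x)) (k * (b * cos (k * w) - a * sin (k * w))).
Proof.
have dk : is_derive w 1 (fun x : R => k * x) k.
  have H : is_derive w 1 (k \*: (id : R -> R)) (k *: (1 : R)) by exact: is_deriveZ.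
  by apply: (is_derive_eq H); rewrite /GRing.scale/= mulr1.
have dc := @is_derive1_comp _ (@cos R) (fun x : R => k * x) w _ _ (is_derive_cos (k * w)) dk.
have ds := @is_derive1_comp _ (@sin R) (fun x : R => k * x) w _ _ (is_derive_sin (k * w)) dk.
have H := is_deriveD (is_deriveZ a dc) (is_deriveZ b ds).
by apply: (is_derive_eq H); rewrite /GRing.scale/=; ring.
Qed.

(** Common form of both parts of [ft p]: the real part has coefficients [Re p] and [Im p], the
    imaginary part [Im p] and [- Re p]. *)
Definition trig_int (a b : R -> R) (w : R) : R :=
  rint mu (fun t => a t * cos (2 * pi * t * w) + b t * sin (2 * pi * t * w)).

Lemma measurable_cos_lin (w : R) : measurable_fun setT (fun t : R => cos (2 * pi * t * w)).
Proof.
apply: measurableT_comp; first by apply: continuous_measurable_fun; exact: continuous_cos.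
by apply: measurable_funM => //; exact: measurable_funM.
Qed.

Lemma measurable_sin_lin (w : R) : measurable_fun setT (fun t : R => sin (2 * pi * t * w)).
Proof.
apply: measurableT_comp; first by apply: continuous_measurable_fun; exact: continuous_sin.
by apply: measurable_funM => //; exact: measurable_funM.
Qed.

Lemma trig_integrable (a b : R -> R) (w : R) : rintegrable mu a -> rintegrable mu b ->
  rintegrable mu (fun t => a t * cos (2 * pi * t * w) + b t * sin (2 * pi * t * w)).
Proof.
move=> ia ib; apply: rintegrableD.
  by apply: (rintegrableM_bounded (M := 1) ia (measurable_cos_lin w)) => t; exact: cos_max.
by apply: (rintegrableM_bounded (M := 1) ib (measurable_sin_lin w)) => t; exact: sin_max.
Qed.

Lemma rintegrable_mul_id (B : R) (a : R -> R) : rintegrable mu a ->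
  (forall t, B < `|t| -> a t = 0) -> rintegrable mu (fun t => t * a t).
Proof.
move=> ia a0; have ma := rintegrable_measurable ia.
apply: rintegrable_le (rintegrableZ B (rintegrable_norm ia)).
  by apply: measurable_funM.
move=> t; rewrite normrM; have [tB|/a0 ->] := leP `|t| B; first by rewrite ler_wpM2r.
by rewrite normr0 !mulr0.
Qed.

Lemma is_derive_trig_int (B : R) (a b : R -> R) (w : R) :
  rintegrable mu a -> rintegrable mu b ->
  (forall t, B < `|t| -> a t = 0) -> (forall t, B < `|t| -> b t = 0) ->
  is_derive w 1 (trig_int a b)
    (2 * pi * trig_int (fun t => t * b t) (fun t => - (t * a t)) w).
Proof.
move=> ia ib a0 b0.
have ita := rintegrable_mul_id ia a0; have itb := rintegrable_mul_id ib b0.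
pose f (x t : R) := a t * cos (2 * pi * t * x) + b t * sin (2 * pi * t * x).
pose df (x t : R) := 2 * pi * t * (b t * cos (2 * pi * t * x) - a t * sin (2 * pi * t * x)).
have fd (x t : R) : is_derive x 1 (f ^~ t) (df x t) by exact: is_derive_trig.
have d1E (x t : R) : partial1of2 f x t = df x t.
  by rewrite partial1of2E; have := fd x t => ?; exact: derive_val.
pose G (t : R) := 2 * pi * (`|t * b t| + `|t * a t|).
have iG : rintegrable mu G by apply/rintegrableZ/rintegrableD; exact: rintegrable_norm.
have Gub (x t : R) : `|df x t| <= G t.
  have p0 := @pi_ge0 R.
  have -> : df x t = 2 * pi * (t * b t * cos (2 * pi * t * x) - t * a t * sin (2 * pi * t * x)).
    by rewrite /df; ring.
  rewrite normrM ger0_norm ?mulr_ge0// ler_wpM2l ?mulr_ge0// (le_trans (ler_normB _ _))//.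
  by rewrite lerD// normrM ler_piMr ?cos_max ?sin_max.
have Iw : `]w - 1, w + 1[%classic w by rewrite /= in_itv/=; apply/andP; split; lra.
have intf (x : R) : `]w - 1, w + 1[%classic x -> mu.-integrable setT (EFin \o f x).
  by move=> _; exact: trig_integrable.
have derf (x t : R) : `]w - 1, w + 1[%classic x -> setT t -> derivable (f ^~ t) x 1.
  by move=> _ _; have := fd x t => -[].
have G0 (t : R) : 0 <= G t by exact: le_trans (Gub 0 t).
have Gub' (x t : R) : `]w - 1, w + 1[%classic x -> setT t -> `|partial1of2 f x t| <= G t.
  by move=> _ _; rewrite d1E.
have D := @derivable_under_integral R _ _ mu f setT measurableT w (w - 1) (w + 1) Iw intf derf
  G G0 iG Gub'.
have V := @differentiation_under_integral R _ _ mu f setT measurableT w (w - 1) (w + 1) Iw intf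
  derf G G0 iG Gub'.
apply: DeriveDef; first exact: D.
rewrite -derive1E; move: V; rewrite /trig_int => ->.
have iNta := rintegrableN ita.
rewrite -rintZ; last exact: trig_integrable.
congr rint; apply/funext => t; rewrite d1E /df; ring.
Qed.

Definition mul_id (p : R -> R[i]) (t : R) : R[i] := t%:C * p t.

Lemma mul_id_integrable (B : R) p : cintegrable mu p -> (forall t, B < `|t| -> p t = 0) ->
  cintegrable mu (mul_id p).
Proof.
move=> [p1 p2] p0; split.
  have := @rintegrable_mul_id B _ p1; rewrite /mul_id => H.
  by under eq_fun do rewrite ReM/= mul0r subr0; apply: H => t /p0 ->.
have := @rintegrable_mul_id B _ p2; rewrite /mul_id => H.
by under eq_fun do rewrite ImM/= mul0r addr0; apply: H => t /p0 ->.
Qed.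

Lemma mul_id_support (B : R) p : (forall t, B < `|t| -> p t = 0) ->
  forall t, B < `|t| -> mul_id p t = 0.
Proof. by move=> p0 t /p0 pt; rewrite /mul_id pt mulr0. Qed.

Section BandLimited.
Variables (B : R) (p : R -> R[i]).
Hypotheses (ip : cintegrable mu p) (p0 : forall t, B < `|t| -> p t = 0).

(** The derivative of [ft p] is [- 2 pi i] times [ft (mul_id p)]; the factor [i] exchanges real and
    imaginary parts. *)
Lemma is_derive_ft (w : R) :
  is_derive w 1 (fun x => complex.Re (ft p x)) (2 * pi * complex.Im (ft (mul_id p) w)) /\
  is_derive w 1 (fun x => complex.Im (ft p x)) (- (2 * pi * complex.Re (ft (mul_id p) w))).
Proof.
have [i1 i2] := ip.
have z1 t : B < `|t| -> complex.Re (p t) = 0 by move=> /p0 ->.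
have z2 t : B < `|t| -> complex.Im (p t) = 0 by move=> /p0 ->.
have z3 t : B < `|t| -> - complex.Re (p t) = 0 by move=> /z1 ->; rewrite oppr0.
have imt := mul_id_integrable ip p0.
split.
  have := is_derive_trig_int w i1 i2 z1 z2.
  have -> : trig_int (fun t => complex.Re (p t)) (fun t => complex.Im (p t)) =
      (fun x => complex.Re (ft p x)).
    apply/funext => x; congr rint; apply/funext => t.
    by rewrite ReM/= cosN sinN; ring.
  move=> H; apply: (is_derive_eq H); congr (_ * _); congr rint; apply/funext => t.
  by rewrite !(ImM, ReM)/= cosN sinN; ring.
have := is_derive_trig_int w i2 (rintegrableN i1) z2 z3.
have -> : trig_int (fun t => complex.Im (p t)) (fun t => - complex.Re (p t)) =
    (fun x => complex.Im (ft p x)).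
  apply/funext => x; congr rint; apply/funext => t.
  by rewrite ImM/= cosN sinN; ring.
move=> H; apply: (is_derive_eq H); rewrite -mulrN; congr (_ * _).
rewrite -rintN; last by have [] := ft_integrand w imt.
congr rint; apply/funext => t.
by rewrite !(ImM, ReM)/= cosN sinN; ring.
Qed.

Lemma continuous_ft : continuous (fun x => complex.Re (ft p x)) /\
  continuous (fun x => complex.Im (ft p x)).
Proof.
split=> w; apply/differentiable_continuous/derivable1_diffP; have [d1 d2] := is_derive_ft w.
  by case: d1.
by case: d2.
Qed.

Lemma cmeasurable_ft : cmeasurable (ft p).
Proof. by have [c1 c2] := continuous_ft; split; exact: continuous_measurable_fun. Qed.

End BandLimited.

Definition zeros_cluster (g : R -> R) (w : R) :=
  forall e : R, 0 < e -> exists h, [/\ 0 < `|h|, `|h| < e & g (w + h) = 0].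

Lemma zeros_cluster_limit (g : R -> R) (w : R) : {for w, continuous g} ->
  zeros_cluster g w -> g w = 0.
Proof.
move=> cg acc; apply/eqP; apply: contrapT => /negP g0.
have ng : 0 < `|g w| by rewrite normr_gt0.
have /cvgrPdist_lt/(_ _ ng) := cg; move=> /nbhs_ballP[e /= e0 He].
have [h [h0 he hz]] := acc _ e0.
have := He (w + h); rewrite -ball_normE /ball_/= opprD addrA subrr add0r normrN => /(_ he).
by rewrite hz subr0 ltxx.
Qed.

(** By continuity [w] itself is a zero, so Rolle's theorem applies between [w] and any nearby zero,
    and gives a zero of [g'] that is closer to [w] and distinct from it. *)
Lemma zeros_cluster_derive (g g' : R -> R) (w : R) :
  (forall x : R, is_derive x 1 g (g' x)) -> zeros_cluster g w -> zeros_cluster g' w.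
Proof.
move=> dg acc.
have der (x : R) : derivable g x 1 by have [] := dg x.
have cg : continuous g by move=> x; apply/differentiable_continuous/derivable1_diffP.
have gw : g w = 0 by apply: zeros_cluster_limit acc; exact: cg.
have rolle a b : a < b -> g a = 0 -> g b = 0 -> exists2 c, a < c < b & g' c = 0.
  move=> ab ga gb.
  have [|c] := Rolle ab (fun x _ => der x) _ (etrans ga (esym gb)).
    exact: continuous_subspaceT.
  rewrite in_itv/= => cab gc; exists c => //.
  by rewrite -(@derive_val _ _ _ _ _ _ _ (dg c)); exact: derive_val.
move=> e e0; have [h [h0 he hz]] := acc _ e0.
have [hp|hn] := ltP 0 h.
  have [c /andP[c1 c2] cz] : exists2 c, w < c < w + h & g' c = 0 by apply: rolle => //; lra.
  exists (c - w); rewrite subrKC gtr0_norm ?subr_gt0//; split => //.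
  by rewrite gtr0_norm// in he; lra.
have hn' : h < 0 by rewrite lt_neqAle hn andbT -normr_gt0.
have [c /andP[c1 c2] cz] : exists2 c, w + h < c < w & g' c = 0 by apply: rolle => //; lra.
exists (c - w); rewrite subrKC ltr0_norm ?subr_lt0//; split => //; first by lra.
by rewrite ltr0_norm// in he; lra.
Qed.

Lemma zeros_clusterZ (k : R) (g : R -> R) (w : R) : k != 0 ->
  zeros_cluster (fun x => k * g x) w -> zeros_cluster g w.
Proof.
move=> k0 acc e e0; have [h [h0 he /eqP]] := acc _ e0.
by rewrite mulf_eq0 (negbTE k0)/= => /eqP hz; exists h.
Qed.

(** Rolle's theorem fails for complex values, so real and imaginary parts are followed separately.
    By induction all derivatives of [ft p] vanish at [w]. Up to constants these are the moments of
    [p t * expi (- (2 * pi * t * w))], a function of bounded support, and [moments_unique]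
    concludes. *)
Lemma ft_zeros_isolated (B : R) (p : R -> R[i]) (w : R) : cintegrable mu p ->
  (forall t, B < `|t| -> p t = 0) ->
  (forall e : R, 0 < e -> exists h, [/\ 0 < `|h|, `|h| < e & ft p (w + h) = 0]) ->
  {ae mu, forall t, p t = 0}.
Proof.
move=> ip p0 acc.
pose P j := iter j mul_id p.
have tp0 : 2 * pi != 0 :> R by rewrite mulf_neq0// gt_eqF// pi_gt0.
have HP j : [/\ cintegrable mu (P j), (forall t, B < `|t| -> P j t = 0),
    zeros_cluster (fun x => complex.Re (ft (P j) x)) w &
    zeros_cluster (fun x => complex.Im (ft (P j) x)) w].
  elim: j => [|j [ij zj r1 r2]].
    split => // e e0; have [h [h0 he hz]] := acc _ e0; exists h; split => //.
      by rewrite hz.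
    by rewrite hz.
  split.
  - exact: mul_id_integrable ij zj.
  - exact: mul_id_support zj.
  - apply: (@zeros_clusterZ (- (2 * pi))); first by rewrite oppr_eq0.
    apply: zeros_cluster_derive r2 => x; have [_ d] := is_derive_ft ij zj x.
    by apply: (is_derive_eq d); rewrite mulNr.
  - apply: (zeros_clusterZ tp0).
    by apply: zeros_cluster_derive r1 => x; have [d _] := is_derive_ft ij zj x.
have Pz j : ft (P j) w = 0.
  have [ij zj r1 r2] := HP j; have [c1 c2] := continuous_ft ij zj.
  apply: complex_ext; first by apply: zeros_cluster_limit r1; exact: c1.
  by apply: zeros_cluster_limit r2; exact: c2.
have PE j t : P j t = (t ^+ j)%:C * p t.
  elim: j => [|j ih]; first by rewrite mul1r.
  by rewrite /P iterS -/(P j) /mul_id ih mulrA -rmorphM exprS.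
pose G t := p t * expi (- (2 * pi * t * w)).
have iG : cintegrable mu G by exact: ft_integrand.
have G0 t : B < `|t| -> G t = 0 by move=> /p0; rewrite /G => ->; rewrite mul0r.
have GP j : cint mu (fun t => (t ^+ j)%:C * G t) = 0.
  rewrite -(Pz j); apply: cint_eq => t; rewrite PE /G; ring.
have : {ae mu, forall t, G t = 0}.
  have [iG1 iG2] := iG.
  apply: complex_ae_eq0.
    apply: moments_unique iG1 _ _ => [t /G0 ->//|j].
    transitivity (complex.Re (0 : R[i])); last by [].
    rewrite -(GP j); congr rint; apply/funext => t.
    by rewrite [in RHS]ReM/= mul0r subr0 mulrC.
  apply: moments_unique iG2 _ _ => [t /G0 ->//|j].
  transitivity (complex.Im (0 : R[i])); last by [].
  rewrite -(GP j); congr rint; apply/funext => t.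
  by rewrite [in RHS]ImM/= mul0r addr0 mulrC.
apply: ae_imply => t /eqP; rewrite /G mulf_eq0 (negbTE (expi_neq0 _)) orbF.
by move/eqP.
Qed.

End Zeros.

(** * Bessel's inequality *)

Section Bessel.
Variables (R : realType) (B : R).
Hypothesis B0 : 0 < B.
Local Notation mu := (@lebesgue_measure R).

Definition band (t : R) : R := (`|t| <= B)%R%:R.

Lemma bandE : band = \1_(`[- B, B]%classic).
Proof. by apply/funext => t; rewrite indicE mem_setE in_itv/= -ler_norml. Qed.

Lemma rint_band : rint mu band = 2 * B.
Proof.
apply: EFin_inj; rewrite rintE; last exact: rintegrable_indic_ball.
rewrite bandE integral_indic//= setIT lebesgue_measure_itv/= lte_fin.
have -> : - B < B by rewrite gtrN.
by rewrite -EFinB; congr EFin; ring.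
Qed.

Lemma sin_pi_natmul n : sin (pi * n%:R) = 0 :> R.
Proof.
elim: n => [|n ih]; first by rewrite mulr0 sin0.
by rewrite -natr1 mulrDr mulr1 sinDpi ih oppr0.
Qed.

(** The integrand is written as the derivative found in [is_derive_trig]. Its primitive has equal
    values at [B] and [- B], because the cosine is even and the sine vanishes at both ends. *)
Lemma rint_band_trig (k a b : R) : sin (k * B) = 0 ->
  rint mu (fun t => band t * (k * (b * cos (k * t) - a * sin (k * t)))) = 0.
Proof.
move=> sk; pose F (x : R) := a * cos (k * x) + b * sin (k * x).
pose f (x : R) := k * (b * cos (k * x) - a * sin (k * x)).
have dF (x : R) : is_derive x 1 F (f x) by exact: is_derive_trig.
have derF (x : R) : derivable F x 1 by case: (dF x).
have cF : continuous F by move=> x; exact/differentiable_continuous/derivable1_diffP.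
have ck : continuous (fun x : R => k * x) by move=> x; apply: cvgMr; exact: cvg_id.
have cf : continuous f.
  move=> x; apply: cvgMr; apply: cvgB; apply: cvgMr.
    by have := cvg_comp _ _ (ck x) (@continuous_cos R (k * x)).
  by have := cvg_comp _ _ (ck x) (@continuous_sin R (k * x)).
have BB : - B < B by rewrite gtrN.
have dd : derivable_oo_LRcontinuous F (- B) B.
  split; first by move=> x _; exact: derF.
    by apply: cvg_at_right_filter; exact: cF.
  by apply: cvg_at_left_filter; exact: cF.
have F'f : {in `](- B), B[, derive1 F =1 f}.
  by move=> x _; rewrite derive1E; have := dF x => ?; exact: derive_val.
have H := continuous_FTC2 BB (continuous_subspaceT cf) dd F'f.
have FB : F (- B) = F B by rewrite /F mulrN cosN sinN sk oppr0.
transitivity (fine (\int[mu]_(x in `[(- B)%R, B]) (f x)%:E)%E).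
  congr fine; rewrite [RHS]integral_mkcond; apply: eq_integral => t _.
  rewrite /patch mem_setE in_itv/= -ler_norml /band.
  by case: ifP => _; rewrite ?mul1r ?mul0r.
by rewrite H FB -EFinB subrr.
Qed.

(** For [F] supported in the band, [ft F t] is the inner product of [F] with [band_exp t]. *)
Definition band_exp (t : R) (xi : R) : R[i] := (band xi)%:C * expi (2 * pi * xi * t).

Lemma band_exp_support t xi : B < `|xi| -> band_exp t xi = 0.
Proof. by move=> h; rewrite /band_exp /band leNgt h/= mul0r. Qed.

Lemma cmeasurable_band_exp t : cmeasurable (band_exp t).
Proof.
apply: cmeasurableM.
  by split => //=; exact: (rintegrable_measurable (rintegrable_indic_ball B)).
by apply: cmeasurable_expi; apply: measurable_funM => //; exact: measurable_funM.
Qed.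

Lemma cnorm2_band_exp t xi : cnorm2 (band_exp t xi) = band xi.
Proof.
rewrite /band_exp cnorm2M cnorm2_expi mulr1 /cnorm2/= expr0n addr0 /band.
by case: (_ <= _); rewrite ?expr1n ?expr0n.
Qed.

Lemma csquare_band_exp t : csquare mu (band_exp t).
Proof.
split; first exact: cmeasurable_band_exp.
by under eq_fun do rewrite cnorm2_band_exp; exact: rintegrable_indic_ball.
Qed.

Lemma csquare_support_integrable F : csquare mu F -> (forall xi, B < `|xi| -> F xi = 0) ->
  cintegrable mu F.
Proof.
move=> sF F0; apply: cintegrable_eq (cintegrableM_square sF (csquare_band_exp 0)) => xi.
have [h|/F0 ->] := leP `|xi| B; last by rewrite mul0r.
by rewrite /band_exp /band h mulr0 expi0 !mulr1.
Qed.

Lemma cintegrable_band_exp t : cintegrable mu (band_exp t).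
Proof.
by apply: csquare_support_integrable; [exact: csquare_band_exp|exact: band_exp_support].
Qed.

Lemma ft_band_exp_orthogonal (t t' : R) k : (0 < k)%N -> t - t' = k%:R / (2 * B) ->
  ft (band_exp t) t' = 0.
Proof.
move=> k0 tt; pose a := pi * k%:R / B.
have p0 := @pi_gt0 R.
have a0 : a != 0 by rewrite mulf_neq0 ?invr_eq0 ?mulf_neq0 ?gt_eqF// ltr0n.
have aB : sin (a * B) = 0 by rewrite /a mulfVK ?gt_eqF// sin_pi_natmul.
have E xi : band_exp t xi * expi (- (2 * pi * xi * t')) = (band xi)%:C * expi (a * xi).
  rewrite /band_exp -mulrA -expiD; congr (_ * expi _).
  have -> : 2 * pi * xi * t - 2 * pi * xi * t' = 2 * pi * xi * (t - t') by ring.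
  by rewrite tt /a; field; rewrite gt_eqF.
rewrite /ft (cint_eq mu E); apply: complex_ext.
  transitivity (rint mu (fun t => band t * (a * (a^-1 * cos (a * t) - 0 * sin (a * t))))).
    congr rint; apply/funext => xi; rewrite ReM/= !mul0r !subr0.
    by rewrite mulVKf.
  exact: rint_band_trig.
transitivity (rint mu (fun t => band t * (a * (0 * cos (a * t) - (- a^-1) * sin (a * t))))).
  congr rint; apply/funext => xi; rewrite ImM/= !mul0r addr0 sub0r mulNr opprK.
  by rewrite mulVKf.
exact: rint_band_trig.
Qed.

(** [F'] is [F] minus its orthogonal projection on [band_exp t], whose squared norm is [2B]. By
    orthogonality the samples lying to the left of [t] by positive multiples of [1 / (2B)] do not
    change. *)
Lemma bessel_step F (t : R) : csquare mu F -> (forall xi, B < `|xi| -> F xi = 0) ->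
  exists F', [/\ csquare mu F', forall xi, B < `|xi| -> F' xi = 0,
    rint mu (fun xi => cnorm2 (F' xi)) =
      rint mu (fun xi => cnorm2 (F xi)) - (2 * B)^-1 * cnorm2 (ft F t) &
    forall t' k, (0 < k)%N -> t - t' = k%:R / (2 * B) -> ft F' t' = ft F t'].
Proof.
move=> sF F0; have iF := csquare_support_integrable sF F0.
pose a := (2 * B)^-1%:C * ft F t.
pose F' xi := F xi - a * band_exp t xi.
have mF' : cmeasurable F'.
  apply: cmeasurableB; first by case: sF.
  by apply: cmeasurableM; [exact: cmeasurable_cst|exact: cmeasurable_band_exp].
have inner xi : conjc a * (F xi * expi (- (2 * pi * xi * t))) =
    conjc a * (F xi * conjc (band_exp t xi)).
  have [h|/F0 ->] := leP `|xi| B; last by rewrite !mul0r.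
  by rewrite /band_exp /band h mul1r -expiN.
have E xi : cnorm2 (F' xi) = cnorm2 (F xi) -
    2 * complex.Re (conjc a * (F xi * expi (- (2 * pi * xi * t)))) + cnorm2 a * band xi.
  by rewrite inner -(cnorm2_band_exp t) -cnorm2M /F' /cnorm2 !ReImE; ring.
have iRe : rintegrable mu (fun xi => complex.Re (conjc a * (F xi * expi (- (2 * pi * xi * t))))).
  by have [] := cintegrableZ (conjc a) (ft_integrand t iF).
have iN : rintegrable mu (fun xi => cnorm2 (F xi)) by case: sF.
have i2Re := rintegrableZ 2 iRe.
have iB := rintegrableZ (cnorm2 a) (rintegrable_indic_ball B).
have iD := rintegrableB iN i2Re.
exists F'; split.
- split => //; under eq_fun do rewrite E.
  exact: rintegrableD.
- by move=> xi h; rewrite /F' F0// band_exp_support// mulr0 subr0.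
- under eq_fun do rewrite E.
  rewrite rintD// rintB// !rintZ//; last exact: rintegrable_indic_ball.
  rewrite rint_band.
  have -> : rint mu (fun xi => complex.Re (conjc a * (F xi * expi (- (2 * pi * xi * t))))) =
      complex.Re (conjc a * ft F t) by rewrite -cintZ//; exact: ft_integrand.
  have -> : complex.Re (conjc a * ft F t) = (2 * B)^-1 * cnorm2 (ft F t).
    by rewrite /a /cnorm2 !ReImE/=; ring.
  have -> : cnorm2 a = (2 * B)^-1 ^+ 2 * cnorm2 (ft F t).
    by rewrite /a cnorm2M /cnorm2/= expr0n addr0.
  by field; rewrite gt_eqF.
- move=> t' k k0 tt; have iE := cintegrable_band_exp t.
  have iaE := cintegrableZ a iE.
  rewrite (ftB t' iF iaE).
  have -> : ft (fun xi => a * band_exp t xi) t' = a * ft (band_exp t) t'.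
    rewrite -cintZ; last exact: ft_integrand.
    by apply: cint_eq => xi; rewrite mulrA.
  by rewrite (ft_band_exp_orthogonal k0 tt) mulr0 subr0.
Qed.

(** The last sample is split off at each step: the others all lie to its left, so the induction
    hypothesis for [F'] still speaks of the samples of [F]. *)
Lemma bessel F (t0 : R) N : csquare mu F -> (forall xi, B < `|xi| -> F xi = 0) ->
  \sum_(n < N) cnorm2 (ft F (t0 + n%:R / (2 * B))) <= 2 * B * rint mu (fun xi => cnorm2 (F xi)).
Proof.
elim: N F => [|N ih] F sF F0.
  have h : 0 <= rint mu (fun xi => cnorm2 (F xi)) by exact: (rint_ge0 mu (fun xi => cnorm2_ge0 (F xi))).
  by rewrite big_ord0 mulr_ge0// mulr_ge0// ltW.
have [F' [sF' F'0 nF' ftF']] := bessel_step (t0 + N%:R / (2 * B)) sF F0.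
have := ih _ sF' F'0; rewrite nF' mulrBr mulVKf ?mulf_neq0 ?gt_eqF// lerBrDr.
rewrite big_ord_recr/=; congr (_ + _ <= _); apply: eq_bigr => n _.
rewrite (ftF' _ (N - n)%N)//; first by rewrite subn_gt0.
by rewrite natrB ?(ltnW (ltn_ord n))//; field; rewrite gt_eqF.
Qed.

Let window (d t : R) : R := (0 <= t < d)%R%:R.

Let window_sum (d a t : R) N : 0 < d ->
  \sum_(n < N) window d (t - (a + n%:R * d)) = window (N%:R * d) (t - a).
Proof.
move=> d0; elim: N => [|N ih].
  rewrite big_ord0 mul0r /window; case: (boolP (_ && _)) => // /andP[h1 h2].
  by have := le_lt_trans h1 h2; rewrite ltxx.
rewrite big_ord_recr/= ih /window -natr1.
have N0 : 0 <= N%:R * d by rewrite mulr_ge0// ltW.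
have [h1|h1] := leP 0 (t - a); last first.
  have -> : (0 <= t - (a + N%:R * d)) = false by apply/negbTE; rewrite -ltNge; lra.
  by rewrite /= addr0.
have [h2|h2] := ltP (t - a) (N%:R * d).
  have -> : (0 <= t - (a + N%:R * d)) = false by apply/negbTE; rewrite -ltNge; lra.
  have -> : (t - a < (N%:R + 1) * d) by rewrite mulrDl mul1r; lra.
  by rewrite /= addr0.
have -> : (0 <= t - (a + N%:R * d)) by lra.
rewrite /= add0r; congr (nat_of_bool _)%:R.
by apply/idP/idP; rewrite mulrDl mul1r; lra.
Qed.

(* Cut the line into translates of [[0, (2B)^-1[ and apply Bessel's inequality to each coset of the
   lattice [(2B)^-1 Z]. *)
Lemma ft_square_integrable F : csquare mu F -> (forall xi, B < `|xi| -> F xi = 0) ->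
  rintegrable mu (fun w => cnorm2 (ft F w)).
Proof.
move=> sF F0; have iF := csquare_support_integrable sF F0.
pose f (w : R) := cnorm2 (ft F w); pose C := 2 * B * rint mu (fun xi => cnorm2 (F xi)).
have f0 w : 0 <= f w by exact: cnorm2_ge0.
have mf : measurable_fun setT f by apply: measurable_cnorm2; exact: cmeasurable_ft iF F0.
have fC w : `|f w| <= C.
  rewrite ger0_norm//; have := bessel w 1 sF F0.
  by rewrite big_ord_recl big_ord0/= mul0r !addr0.
pose d := (2 * B)^-1.
have d0 : 0 < d by rewrite invr_gt0 mulr_gt0.
have windowE e : window e = \1_(`[0, e[%classic).
  by apply/funext => t; rewrite indicE mem_setE in_itv.
have iw : rintegrable mu (window d) by rewrite windowE; exact: integrable_indic_itv.
have rw : rint mu (window d) = d.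
  apply: EFin_inj; rewrite rintE//.
  by rewrite windowE integral_indic//= setIT lebesgue_measure_itv/= lte_fin d0 sube0.
have iwf s : rintegrable mu (fun t => window d t * f (t + s)).
  apply: (rintegrableM_bounded (M := C)) => //.
  by apply: measurableT_comp => //; exact: measurable_addl.
have ifw s : rintegrable mu (fun t => f t * window d (t - s)).
  apply: rintegrable_eq (rintegrable_translation (- s) (iwf s)) => t.
  by rewrite subrK mulrC.
have shift s : rint mu (fun t => f t * window d (t - s)) = rint mu (fun t => window d t * f (t + s)).
  rewrite -(rint_translation (- s) (iwf s)); congr rint; apply/funext => t.
  by rewrite subrK mulrC.
(* Each translation is moved from the cell to [f]: an integral of [f] over many cells becomes the
   integral over one cell of a sum of samples, to which [bessel] applies. *)
have sumE a N : [/\ rintegrable mu (fun t => f t * \sum_(n < N) window d (t - (a + n%:R * d))),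
    rintegrable mu (fun t => window d t * \sum_(n < N) f (t + (a + n%:R * d))) &
    rint mu (fun t => f t * \sum_(n < N) window d (t - (a + n%:R * d))) =
    rint mu (fun t => window d t * \sum_(n < N) f (t + (a + n%:R * d)))].
  elim: N => [|N [i1 i2 ih]].
    under eq_fun do rewrite big_ord0 mulr0.
    under [X in _ = rint _ X]eq_fun do rewrite big_ord0 mulr0.
    by split; [exact: rintegrable0|under eq_fun do rewrite big_ord0 mulr0; exact: rintegrable0|].
  split.
  - by under eq_fun do rewrite big_ord_recr/= mulrDr; exact: rintegrableD.
  - by under eq_fun do rewrite big_ord_recr/= mulrDr; exact: rintegrableD.
  - under eq_fun do rewrite big_ord_recr/= mulrDr.
    under [X in _ = rint _ X]eq_fun do rewrite big_ord_recr/= mulrDr.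
    by rewrite !rintD// ih shift.
pose S (N : nat) : set R := `[- (N%:R * d), N%:R * d[%classic.
(* [N + N] cells starting at [- N d] tile [S N]. The bound does not depend on [N], so monotone
   convergence carries it to the whole line. *)
have bound N : (\int[mu]_(t in S N) (f t)%:E <= (d * C)%:E)%E.
  have [i1 i2 e] := sumE (- (N%:R * d)) (N + N)%N.
  have le2 : rint mu (fun t => window d t * \sum_(n < N + N) f (t + (- (N%:R * d) + n%:R * d))) <= d * C.
    have -> : d * C = rint mu (fun t => C * window d t) by rewrite rintZ// rw mulrC.
    apply: rint_le => //; first exact: rintegrableZ.
    move=> t; rewrite mulrC ler_wpM2r//.
    have := bessel (t + - (N%:R * d)) (N + N) sF F0.
    by under eq_bigr do rewrite -addrA.
  rewrite -e in le2.
  suff -> : (\int[mu]_(t in S N) (f t)%:E = (rint mu (fun t => f t *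
      \sum_(n < N + N) window d (t - (- (N%:R * d) + n%:R * d))))%:E)%E by rewrite lee_fin.
  rewrite rintE//.
  rewrite [LHS]integral_mkcond; apply: eq_integral => t _.
  have we : window ((N + N)%:R * d) (t + N%:R * d) = ((- (N%:R * d) <= t) && (t < N%:R * d))%:R.
    by rewrite /window natrD mulrDl ltrD2r -[- _ <= t]subr_ge0 opprK.
  rewrite window_sum// opprK we /patch /S mem_setE in_itv/=.
  by case: ifP => _; rewrite ?mulr1 ?mulr0.
have mfE : measurable_fun setT (EFin \o f) by exact/measurable_EFinP.
have ndS : nondecreasing_seq S.
  apply/nondecreasing_seqP => n; apply/subsetPset => t; rewrite /S /= !in_itv/= => /andP[h1 h2].
  have h : n%:R * d <= n.+1%:R * d by rewrite ler_pM2r// ler_nat.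
  by apply/andP; split; lra.
have mS n : measurable (S n) by exact: measurable_itv.
have mfS n : measurable_fun (S n) (EFin \o f) by exact: measurable_funS mfE.
have fS n t : S n t -> (0 <= (EFin \o f) t)%E by move=> _; rewrite /= lee_fin.
have cv := @ge0_nondecreasing_set_cvg_integral _ (measurableTypeR R) R S (EFin \o f) mu ndS mS mfS fS.
have SU : \bigcup_i S i = setT.
  apply/seteqP; split => // t _; exists (Num.trunc (`|t| / d)).+1 => //.
  have : `|t| < (Num.trunc (`|t| / d)).+1%:R * d by rewrite -ltr_pdivrMr// truncnS_gt.
  by rewrite /S /= in_itv/= ltr_norml => /andP[/ltW -> ->].
rewrite SU in cv.
apply/integrableP; split => //.
have -> : (\int[mu]_x `|(EFin \o f) x|)%E = (\int[mu]_x (EFin \o f) x)%E.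
  by apply: eq_integral => t _; rewrite /= ger0_norm.
apply: (@le_lt_trans _ _ (d * C)%:E); last exact: ltry.
rewrite -(cvg_lim _ cv)//; apply: lime_le; first exact: cvgP cv.
by apply: nearW => n; exact: bound.
Qed.

(** Conjugation replaces the change of variable [t -> - t]: [ft F (- t)] has the same modulus as the
    transform of [conjc F] at [t]. *)
Lemma csquare_ft F : csquare mu F -> (forall xi, B < `|xi| -> F xi = 0) ->
  csquare mu (fun t => ft F (- t)).
Proof.
move=> sF F0; have iF := csquare_support_integrable sF F0.
have [m1 m2] := cmeasurable_ft iF F0.
have mN : measurable_fun setT (fun t : R => - t) by exact: measurable_funN.
split; first by split; [apply: (measurableT_comp m1)|apply: (measurableT_comp m2)].
have F0' xi : B < `|xi| -> conjc (F xi) = 0 by move=> /F0 ->; exact: conjc0.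
have := ft_square_integrable (csquareJ sF) F0'.
apply: rintegrable_eq => w; rewrite -cnorm2J ftJ ?opprK//; last exact: cintegrableJ.
by have -> : (fun t => conjc (conjc (F t))) = F by apply/funext => t; exact: conjcK.
Qed.

End Bessel.

(** * Paley-Wiener functions *)

Section PaleyWiener.
Variables (R : realType) (B : R).
Hypothesis B0 : 0 < B.
Local Notation mu := (@lebesgue_measure R).

(** The spectrum is extended by zero, so all integrals run over the whole line and translations do
    not change their domain. In [PW2] the values of [F] outside the band are arbitrary;
    [PW2_extension] cuts them off. *)
Definition band_limited (F : R -> R[i]) :=
  csquare mu F /\ forall xi, B < `|xi| -> F xi = 0.

Lemma band_limited_integrable F : band_limited F -> cintegrable mu F.
Proof. by move=> [sF F0]; exact: csquare_support_integrable sF F0. Qed.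

Definition extension (F : R -> R[i]) (z : R[i]) : R[i] :=
  cint mu (fun xi => F xi * cexp ((2 * pi * xi)%:C * 'i * z)).

Lemma cexp_line (xi : R) (z : R[i]) : cexp ((2 * pi * xi)%:C * 'i * z) =
  (expR (- (2 * pi * complex.Im z * xi)))%:C * expi (2 * pi * complex.Re z * xi).
Proof.
rewrite -complexiE /cexp; case: z => x y /=.
by congr ((expR _)%:C * expi _); rewrite ?ReImE/=; ring.
Qed.

Lemma extension_real F (t : R) : extension F t%:C = ft F (- t).
Proof.
apply: cint_eq => xi; rewrite cexp_line/= mulr0 mul0r oppr0 expR0 mul1r.
by congr (_ * expi _); ring.
Qed.

Lemma PW2_extension f : PW2 B f ->
  exists F, band_limited F /\ forall z, f z = extension F z.
Proof.
move=> [F [[m1 [m2 iF]] fE]]; pose D := `[- B, B]%classic.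
have mD : measurable D by exact: measurable_itv.
pose F0 xi := (band B xi)%:C * F xi.
have bandR (u : R -> R) : (fun t => band B t * u t) = u \_ D.
  apply/funext => t; rewrite /patch /D mem_setE in_itv/= -ler_norml /band.
  by case: ifP => _; rewrite ?mul1r ?mul0r.
have ReF0 xi (z : R[i]) : complex.Re ((band B xi)%:C * z) = band B xi * complex.Re z.
  by rewrite ReM/= mul0r subr0.
have ImF0 xi (z : R[i]) : complex.Im ((band B xi)%:C * z) = band B xi * complex.Im z.
  by rewrite ImM/= mul0r addr0.
exists F0; split.
  split; last by move=> xi h; rewrite /F0 /band leNgt h/= mul0r.
  split.
    split.
      under eq_fun do rewrite ReF0; rewrite (bandR (fun xi => complex.Re (F xi))).
      exact/(measurable_restrictT _ mD).
    under eq_fun do rewrite ImF0; rewrite (bandR (fun xi => complex.Im (F xi))).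
    exact/(measurable_restrictT _ mD).
  have -> : (fun xi => cnorm2 (F0 xi)) = (fun xi => cnorm2 (F xi)) \_ D.
    rewrite -bandR; apply/funext => xi; rewrite /F0 cnorm2M {1}/cnorm2/= expr0n addr0 /band.
    by case: (_ <= _); rewrite ?expr1n ?expr0n.
  have := (@integrable_mkcond _ (measurableTypeR R) _ mu D _ mD).1 iF.
  by rewrite /rintegrable -restrict_EFin.
move=> z; rewrite fE /cintegral /extension; congr Complex.
  rewrite Rintegral_mkcond -bandR; congr rint; apply/funext => xi.
  by rewrite /F0 -(mulrA (band B xi)%:C) ReF0.
rewrite Rintegral_mkcond -bandR; congr rint; apply/funext => xi.
by rewrite /F0 -(mulrA (band B xi)%:C) ImF0.
Qed.

Lemma cmeasurable_cexp (z : R[i]) :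
  cmeasurable (fun xi : R => cexp ((2 * pi * xi)%:C * 'i * z)).
Proof.
under eq_fun do rewrite cexp_line.
apply: cmeasurableM; last by apply: cmeasurable_expi; exact: measurable_funM.
split => //=; apply: measurableT_comp => //; apply: measurable_funN.
exact: measurable_funM.
Qed.

Lemma extension_integrable F z : band_limited F ->
  cintegrable mu (fun xi => F xi * cexp ((2 * pi * xi)%:C * 'i * z)).
Proof.
move=> bF; have iF := band_limited_integrable bF; have [_ F0] := bF.
(* Off the real axis the exponential kernel is unbounded on the line; restricted to the band it is
   bounded by [M] below. *)
pose k xi := (band B xi)%:C * cexp ((2 * pi * xi)%:C * 'i * z).
have E xi : F xi * k xi = F xi * cexp ((2 * pi * xi)%:C * 'i * z).
  have [h|/F0 ->] := leP `|xi| B; last by rewrite !mul0r.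
  by rewrite /k /band h mul1r.
apply: (@cintegrable_eq _ _ _ mu _ _ E).
pose M := expR (2 * pi * `|complex.Im z| * B).
have bd xi (c : R) : `|c| <= 1 ->
    `|band B xi * (expR (- (2 * pi * complex.Im z * xi)) * c)| <= M.
  move=> c1; have M0 : 0 <= M by exact: expR_ge0.
  rewrite /band; case: (leP `|xi| B) => [h|_]; last by rewrite mul0r normr0.
  rewrite mul1r normrM ger0_norm ?expR_ge0// (@le_trans _ _ (expR (- (2 * pi * complex.Im z * xi))))//.
    by rewrite ler_piMr ?expR_ge0.
  have -> : M = expR (`|2 * pi * complex.Im z| * B).
    by rewrite !normrM (ger0_norm (@pi_ge0 R)) (@ger0_norm _ 2).
  by rewrite ler_expR (le_trans (ler_norm _))// normrN normrM ler_wpM2l.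
have ReK xi : complex.Re (k xi) =
    band B xi * (expR (- (2 * pi * complex.Im z * xi)) * cos (2 * pi * complex.Re z * xi)).
  by rewrite /k cexp_line !ReM/= !mul0r !subr0.
have ImK xi : complex.Im (k xi) =
    band B xi * (expR (- (2 * pi * complex.Im z * xi)) * sin (2 * pi * complex.Re z * xi)).
  by rewrite /k cexp_line !ImM/= !mul0r !addr0.
apply: (cintegrableM_bounded (M := M)) => //.
- apply: cmeasurableM; last exact: cmeasurable_cexp.
  by split => //=; exact: (rintegrable_measurable (rintegrable_indic_ball B)).
- by move=> xi; rewrite ReK; apply: bd; exact: cos_max.
- by move=> xi; rewrite ImK; apply: bd; exact: sin_max.
Qed.

(** Modulation by [t0] brings the samples to the multiples of [c], where [ft_sampling_unique] yields
    [F = rho * G] almost everywhere. An equality of spectra gives the conclusion at complex [z]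
    without analytic continuation. *)
Lemma extension_eq_of_samples (c t0 : R) (rho : R[i]) F G : 0 < c -> c <= (2 * B)^-1 ->
  band_limited F -> band_limited G ->
  (forall n : int, ft F (- (t0 + n%:~R * c)) = rho * ft G (- (t0 + n%:~R * c))) ->
  forall z, extension F z = rho * extension G z.
Proof.
move=> c0 cB bF bG FG z.
have iF := band_limited_integrable bF; have iG := band_limited_integrable bG.
pose D xi := F xi - rho * G xi.
have iD : cintegrable mu D by apply: cintegrableB => //; exact: cintegrableZ.
pose h xi := D xi * expi (2 * pi * xi * t0).
have ih : cintegrable mu h.
  by apply: cintegrableM_expi => //; apply: measurable_funM => //; exact: measurable_funM.
have D0 xi : B < `|xi| -> D xi = 0.
  by move=> hx; rewrite /D bF.2// bG.2// mulr0 subr0.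
have ftD w : ft D w = ft F w - rho * ft G w.
  rewrite ftB//; last exact: cintegrableZ.
  congr (_ - _); rewrite -cintZ; last exact: ft_integrand.
  by apply: cint_eq => xi; rewrite mulrA.
have : {ae mu, forall xi, h xi = 0}.
  apply: (ft_sampling_unique B0 c0 cB ih) => [xi hx|n]; first by rewrite /h D0// mul0r.
  (* The transform of [h] at [n c] is that of [D] at [n c - t0], hence the sample of index [- n]. *)
  transitivity (ft D (- (t0 + (- n)%:~R * c))); last by rewrite ftD FG subrr.
  apply: cint_eq => xi; rewrite /h -mulrA -expiD; congr (_ * expi _).
  by rewrite rmorphN/=; ring.
move=> hae.
have FrG : {ae mu, forall xi, F xi = rho * G xi}.
  apply: ae_imply hae => xi /eqP; rewrite /h mulf_eq0 (negbTE (expi_neq0 _)) orbF.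
  by rewrite subr_eq0 => /eqP.
rewrite -cintZ; last exact: extension_integrable.
have mc := cmeasurable_cexp z.
have mF := cintegrable_measurable iF; have mG := cintegrable_measurable iG.
apply: cint_ae.
- exact: cmeasurableM.
- by apply: cmeasurableM; [exact: cmeasurable_cst|exact: cmeasurableM].
- by apply: ae_imply FrG => xi ->; rewrite mulrA.
Qed.

(** A set without limit points is countable. The shifts whose progression meets a zero then form a
    countable union of countable sets, a null set, which cannot be the whole line. *)
Lemma exists_shift_nonzero (c : R) G : band_limited G ->
  (exists t0 : R, forall n : int, ft G (- (t0 + n%:~R * c)) != 0) \/
  (forall w, ft G w = 0).
Proof.
move=> bG; have iG := band_limited_integrable bG.
pose Z : set R := [set t | ft G t = 0].
have [[w wZ]|noacc] := pselect (exists w, limit_point Z w).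
  right => v; have ae0 : {ae mu, forall t, G t = 0}.
    apply: (ft_zeros_isolated (w := w) iG bG.2) => e e0.
    have [y [yw Zy]] := wZ _ (nbhsx_ballx w e e0).
    rewrite -ball_normE /ball_/= => wy; exists (y - w); rewrite subrKC; split => //.
      by rewrite normr_gt0 subr_eq0.
    by rewrite distrC.
  transitivity (ft (fun=> 0 : R[i]) v).
    by apply: ft_ae ae0; [exact: cintegrable_measurable iG|exact: cmeasurable_cst].
  by rewrite /ft; under cint_eq do rewrite mul0r; rewrite (cint_real mu (fun=> 0)) rint0.
left.
have cZ : countable Z.
  apply: sub_countable (countable_isolated Z); apply: subset_card_le => t Zt.
  have : closure Z t by exact: subset_closure.
  rewrite closure_isolated_limit_point => -[//|lt].
  by exfalso; apply: noacc; exists t.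
pose bad : set R := \bigcup_(n in [set: int]) ((fun z => - z - n%:~R * c) @` Z).
have cbad : countable bad.
  by apply: bigcup_countable => // n _; exact: sub_countable (card_image_le _ _) cZ.
have mbad : mu bad = 0%E by exact: countable_lebesgue_measure0.
have [t0 nt0] : exists t0, ~ bad t0.
  apply: contrapT => /forallNP H.
  have bT : bad = setT by apply/seteqP; split => // t _; apply: contrapT; exact: H.
  have : (mu `[0%R, 1%R]%classic <= mu setT)%E by apply: le_measure; rewrite ?inE.
  by rewrite -bT mbad lebesgue_measure_itv/= lte01 sube0 lee_fin ler10.
exists t0 => n; apply/eqP => zn; apply: nt0; exists n => //.
by exists (- (t0 + n%:~R * c)) => //; rewrite opprK addrK.
Qed.

(** With [a_n] and [b_n] the values at [t0 + n c], the product identity gives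
    [a_(n+1) / b_(n+1) = conj b_n / conj a_n], and equal moduli turn the right-hand side into
    [a_n / b_n]. The common ratio has modulus 1. *)
Lemma shift_ratio_constant (a b : R -> R[i]) (c t0 : R) :
  (forall t, cnorm2 (a t) = cnorm2 (b t)) ->
  (forall t, a (c + t) * conjc (a t) = b (c + t) * conjc (b t)) ->
  (forall n : int, b (t0 + n%:~R * c) != 0) ->
  exists alpha, forall n : int, a (t0 + n%:~R * c) = expi alpha * b (t0 + n%:~R * c).
Proof.
move=> nab cab b0.
pose x (n : int) := a (t0 + n%:~R * c); pose y (n : int) := b (t0 + n%:~R * c).
have y0 n : y n != 0 by exact: b0.
have nxy n : cnorm2 (x n) = cnorm2 (y n) by exact: nab.
have x0 n : x n != 0 by rewrite -cnorm2_eq0 nxy cnorm2_eq0.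
have step n : x (n + 1) / y (n + 1) = x n / y n.
  have := cab (t0 + n%:~R * c).
  have -> : c + (t0 + n%:~R * c) = t0 + (n + 1)%:~R * c by rewrite rmorphD/=; ring.
  rewrite -/(x _) -/(x n) -/(y _) -/(y n) => e.
  apply/eqP; rewrite eqr_div//; apply/eqP.
  have cx0 : conjc (x n) != 0 by rewrite -cnorm2_eq0 cnorm2J cnorm2_eq0.
  apply: (mulIf cx0); rewrite mulrAC e.
  have : x n * conjc (x n) = y n * conjc (y n) by rewrite !mulcJ nxy.
  move=> e2; transitivity (y (n + 1) * (x n * conjc (x n))); last by ring.
  by rewrite e2; ring.
have const n : x n / y n = x 0 / y 0.
  have pos (k : nat) : x k / y k = x 0 / y 0.
    elim: k => [//|k <-]; have -> : k.+1%:Z = k%:Z + 1 by rewrite -addn1 PoszD.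
    exact: step.
  have neg (k : nat) : x (- k%:Z) / y (- k%:Z) = x 0 / y 0.
    elim: k => [|k <-]; first by rewrite oppr0.
    by rewrite -(step (- k.+1%:Z)) -addn1 PoszD opprD addrNK.
  by case: (intP n) => [//|k|k]; [exact: (pos k.+1)|exact: (neg k.+1)].
have [alpha ea] : exists alpha, x 0 / y 0 = expi alpha.
  apply: normc1_expi; have h : cnorm2 (x 0 / y 0) * cnorm2 (y 0) = cnorm2 (y 0).
    by rewrite -cnorm2M divfK.
  have ny0 : cnorm2 (y 0) != 0 by rewrite cnorm2_eq0.
  by apply: (mulIf ny0); rewrite h mul1r.
exists alpha => n; rewrite -ea -(const n) -/(x n) -/(y n).
by rewrite divfK.
Qed.

Lemma cnorm2_ft_bounded F : band_limited F ->
  exists C, forall w, cnorm2 (ft F w) <= C.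
Proof.
move=> [sF F0]; exists (2 * B * rint mu (fun xi => cnorm2 (F xi))) => w.
have := bessel B0 w 1 sF F0.
by rewrite big_ord_recl big_ord0/= mul0r !addr0.
Qed.

(** * From the modulus of the transform to the products [f (s + e) * conj (f e)] *)

Section PhaseRetrieval.
Variable phi : R -> R[i].
Hypothesis sphi : csquare mu phi.

(** Integrable as a product of two square integrable functions, and square integrable because its
    first factor is bounded; [autocorrelation_eq] asks for both. *)
Definition windowed (F : R -> R[i]) (x t : R) : R[i] := ft F (- t) * conjc (phi (t - x)).

Lemma csquare_windowed F x : band_limited F -> csquare mu (windowed F x).
Proof.
move=> bF; have [C FC] := cnorm2_ft_bounded bF.
have [[mf _] _] := csquare_ft B0 bF.1 bF.2.
have sp := csquareJ (csquare_translation (- x) sphi).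
have [mF _] := csquare_ft B0 bF.1 bF.2.
have := csquareM_bounded sp mF (fun t => FC (- t)).
by move=> [m i]; split; [move: m|move: i]; under eq_fun do rewrite mulrC.
Qed.

Lemma cintegrable_windowed F x : band_limited F -> cintegrable mu (windowed F x).
Proof.
move=> bF; apply: cintegrableM_square; first exact: (csquare_ft B0 bF.1 bF.2).
exact/csquareJ/(csquare_translation (- x) sphi).
Qed.

Definition lag_product (s y : R) : R[i] := conjc (phi (s + y)) * phi y.

Lemma lag_product_integrable s : cintegrable mu (lag_product s).
Proof.
apply: cintegrableM_square => //; apply: csquareJ.
have [m i] := csquare_translation s sphi.
by split; [move: m|move: i]; under eq_fun do rewrite addrC.
Qed.

(** Substituting [t + s] for [t] in [STFT phi phi s w] gives, up to a unimodular factor, the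
    conjugate of [ft (lag_product s) (- w)]. *)
Lemma ft_lag_product_neq0 (s w : R) : ambiguity phi s w != 0 -> ft (lag_product s) (- w) != 0.
Proof.
apply: contraNneq => h; rewrite /ambiguity mulf_eq0 (negbTE (expi_neq0 _))/=.
have ip := cintegrableJ (lag_product_integrable s).
have e : conjc (ft (fun y => conjc (lag_product s y)) w) = 0.
  rewrite (ftJ w ip) -h; congr ft; apply/funext => y; exact: conjcK.
have {}e : ft (fun y => conjc (lag_product s y)) w = 0 by rewrite -[LHS]conjcK e conjc0.
have iS : cintegrable mu (fun t => phi t * conjc (phi (t - s)) * expi (- (2 * pi * t * w))).
  apply: (ft_integrand w (p := fun t => phi t * conjc (phi (t - s)))).
  apply: cintegrableM_square => //; exact/csquareJ/(csquare_translation (- s) sphi).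
have -> : STFT phi phi s w =
    cint mu (fun t => phi t * conjc (phi (t - s)) * expi (- (2 * pi * t * w))) by [].
rewrite -(cint_translation s iS).
have E t : phi (t + s) * conjc (phi (t + s - s)) * expi (- (2 * pi * (t + s) * w)) =
    expi (- (2 * pi * s * w)) * (conjc (lag_product s t) * expi (- (2 * pi * t * w))).
  rewrite addrK /lag_product conjcM conjcK (addrC s t).
  have -> : expi (- (2 * pi * (t + s) * w)) =
      expi (- (2 * pi * s * w)) * expi (- (2 * pi * t * w)).
    by rewrite -expiD; congr expi; ring.
  by ring.
rewrite (cint_eq mu E) cintZ; last exact: ft_integrand.
by rewrite -/(ft (fun y => conjc (lag_product s y)) w) e mulr0.
Qed.

(** The spectrum of [e -> f (s + e) * conj (f e)], where [f e = ft F (- e)]: modulating [F]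
    translates [f], and correlating spectra multiplies functions. Building it from [F] makes its
    support visible and avoids inverting a transform. *)
Definition modulated_corr (F : R -> R[i]) (s : R) : R -> R[i] :=
  corr (fun xi => F xi * expi (2 * pi * xi * s)) (fun xi => conjc (F xi)).

Lemma modulated_integrable F s : band_limited F ->
  cintegrable mu (fun xi => F xi * expi (2 * pi * xi * s)).
Proof.
move=> /band_limited_integrable iF; apply: cintegrableM_expi => //.
by apply: measurable_funM => //; exact: measurable_funM.
Qed.

Lemma modulated_corr_integrable F s : band_limited F -> cintegrable mu (modulated_corr F s).
Proof.
move=> bF; apply: corr_integrable; first exact: modulated_integrable.
exact/cintegrableJ/band_limited_integrable.
Qed.

Lemma ft_modulated_corr F s e : band_limited F ->
  ft (modulated_corr F s) (- e) = ft F (- (s + e)) * conjc (ft F (- e)).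
Proof.
move=> bF; have iF := band_limited_integrable bF.
rewrite ft_corr; [|exact: modulated_integrable|exact: cintegrableJ].
rewrite ftJ//; congr (_ * _); apply: cint_eq => xi.
by rewrite -mulrA -expiD; congr (_ * expi _); ring.
Qed.

Lemma modulated_corr_support F s w : band_limited F -> 2 * B < `|w| -> modulated_corr F s w = 0.
Proof.
move=> bF hw; transitivity (cint mu (fun=> 0 : R[i])); last first.
  by rewrite (cint_real mu (fun=> 0)) rint0.
apply: cint_eq => e.
have [h|/bF.2 ->] := leP `|e| B; last by rewrite conjc0 mulr0.
rewrite bF.2 ?mul0r//; have := ler_normB (w + e) e; rewrite addrK; lra.
Qed.

Lemma windowed_autocorrelation F x s : band_limited F ->
  cintegrable mu (fun e => ft (modulated_corr F s) (- e) * lag_product s (e - x)) /\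
  corr (windowed F x) (fun t => conjc (windowed F x t)) s =
  cint mu (fun e => ft (modulated_corr F s) (- e) * lag_product s (e - x)).
Proof.
move=> bF; have sW := csquare_windowed x bF.
have E e : windowed F x (s + e) * conjc (windowed F x e) =
    ft (modulated_corr F s) (- e) * lag_product s (e - x).
  by rewrite ft_modulated_corr// /windowed /lag_product conjcM conjcK addrA; ring.
split; last exact: cint_eq.
apply: (@cintegrable_eq _ _ _ mu _ _ E); apply: cintegrableM_square; last exact: csquareJ.
have [m i] := csquare_translation s sW.
by split; [move: m|move: i]; under eq_fun do rewrite addrC.
Qed.

Lemma products_agree F G s : band_limited F -> band_limited G ->
  (forall x w, cnorm2 (ft (windowed F x) w) = cnorm2 (ft (windowed G x) w)) ->
  {ae mu, forall w : R, w \in `](- (2 * B)), (2 * B)[ -> ambiguity phi s w != 0} ->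
  forall e, ft F (- (s + e)) * conjc (ft F (- e)) = ft G (- (s + e)) * conjc (ft G (- e)).
Proof.
move=> bF bG FG amb e.
have iF := modulated_corr_integrable s bF; have iG := modulated_corr_integrable s bG.
pose D w := modulated_corr F s w - modulated_corr G s w.
have iD : cintegrable mu D by exact: cintegrableB.
have pair0 x : cint mu (fun e => ft D (- e) * lag_product s (e - x)) = 0.
  have [iF' eF] := windowed_autocorrelation x s bF.
  have [iG' eG] := windowed_autocorrelation x s bG.
  have := autocorrelation_eq (cintegrable_windowed x bF) (csquare_windowed x bF)
    (cintegrable_windowed x bG) (csquare_windowed x bG) (FG x) s.
  rewrite eF eG => /eqP; rewrite -subr_eq0 -(cintB iF' iG') => /eqP <-.
  by apply: cint_eq => e'; rewrite ftB// mulrBl.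
have Dpsi := pairing_eq0 iD (lag_product_integrable s) pair0.
(* The hypothesis on [ambiguity] covers the open interval and the support condition [|w| > 2B]; the
   two endpoints in between are a null set. *)
have edge : {ae mu, forall w, (w != 2 * B) /\ (w != - (2 * B))}.
  by apply: ae_imply2 (ae_neq (2 * B)) (ae_neq (- (2 * B))) => w.
have Dpsi' : {ae mu, forall w, D w * ft (lag_product s) (- w) = 0 /\ (w != 2 * B) /\ (w != - (2 * B))}.
  by apply: ae_imply2 Dpsi edge => w.
have D0 : {ae mu, forall w, D w = 0}.
  apply: ae_imply2 amb Dpsi' => w aw [Dw [w1 w2]].
  have [h|h] := ltP `|w| (2 * B).
    have wI : w \in `](- (2 * B)), (2 * B)[ by rewrite in_itv/= -ltr_norml.
    by move/eqP: Dw; rewrite mulf_eq0 (negbTE (ft_lag_product_neq0 (aw wI))) orbF => /eqP.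
  have hw : 2 * B < `|w|.
    rewrite lt_neqAle h andbT; apply/negP => /eqP hh.
    have [w0|w0] := leP 0 w; first by rewrite hh ger0_norm// eqxx in w1.
    by rewrite hh ltr0_norm// opprK eqxx in w2.
  by rewrite /D !modulated_corr_support// subrr.
have : ft D (- e) = 0.
  transitivity (ft (fun=> 0 : R[i]) (- e)).
    by apply: ft_ae D0; [exact: cintegrable_measurable iD|exact: cmeasurable_cst].
  by rewrite /ft; under cint_eq do rewrite mul0r; rewrite (cint_real mu (fun=> 0)) rint0.
by rewrite ftB// !ft_modulated_corr// => /eqP; rewrite subr_eq0 => /eqP.
Qed.

End PhaseRetrieval.

End PaleyWiener.

Unset Implicit Arguments.
Set Strict Implicit.

Theorem theorem3p1 (R : realType) (B c : R) (phi : R -> R[i]) :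
  0 < B -> 0 < c -> c <= (2 * B)^-1 ->
  L2 phi ->
  {ae (@lebesgue_measure R), forall w : R, w \in `](- (2 * B)), (2 * B)[ ->
      ambiguity phi 0 w != 0 /\ ambiguity phi c w != 0} ->
  forall f g : R[i] -> R[i], PW2 B f -> PW2 B g ->
    ((exists alpha : R, forall z : R[i], f z = expi alpha * g z) <->
     (forall x w : R, `| STFT phi (fun t => f t%:C) x w | =
                      `| STFT phi (fun t => g t%:C) x w |)).
Proof.
move=> B0 c0 cB [mRe [mIm iphi]] amb f g pf pg.
pose mu := @lebesgue_measure R.
have sphi : csquare mu phi by split.
have [F [bF fE]] := PW2_extension pf; have [G [bG gE]] := PW2_extension pg.
have line (h : R[i] -> R[i]) H : (forall z, h z = extension H z) ->
    forall t : R, h t%:C = ft H (- t) by move=> hE t; rewrite hE extension_real.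
have STFTE (h : R[i] -> R[i]) H x w : (forall z, h z = extension H z) ->
    STFT phi (fun t => h t%:C) x w = ft (windowed phi H x) w.
  move=> hE; transitivity (cint mu (fun t => h t%:C * conjc (phi (t - x)) *
    expi (- (2 * pi * t * w)))) => //.
  by apply: cint_eq => t; rewrite (line h H hE).
split=> [[alpha fg] x w|eqV].
  rewrite (STFTE f F x w fE) (STFTE g G x w gE); apply/normc_eq_cnorm2.
  have iG := ft_integrand w (cintegrable_windowed B0 sphi x bG).
  have -> : ft (windowed phi F x) w = expi alpha * ft (windowed phi G x) w.
    rewrite -(cintZ _ iG); apply: cint_eq => t.
    by rewrite /windowed -(line f F fE) -(line g G gE) fg !mulrA.
  by rewrite cnorm2M cnorm2_expi mul1r.
have FG x w : cnorm2 (ft (windowed phi F x) w) = cnorm2 (ft (windowed phi G x) w).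
  by apply/normc_eq_cnorm2; rewrite -(STFTE f F x w fE) -(STFTE g G x w gE).
have amb0 : {ae mu, forall w : R, w \in `](- (2 * B)), (2 * B)[ -> ambiguity phi 0 w != 0}.
  by apply: ae_imply amb => w h /h[].
have ambc : {ae mu, forall w : R, w \in `](- (2 * B)), (2 * B)[ -> ambiguity phi c w != 0}.
  by apply: ae_imply amb => w h /h[].
have modulus t : cnorm2 (ft F (- t)) = cnorm2 (ft G (- t)).
  have := products_agree B0 sphi bF bG FG amb0 t.
  by rewrite add0r !mulcJ => /complexI.
have product := products_agree B0 sphi bF bG FG ambc.
have [[t0 nz]|G0] := exists_shift_nonzero c bG.
  have [alpha ratio] := @shift_ratio_constant _ (fun t => ft F (- t)) (fun t => ft G (- t))
    c t0 modulus product nz.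
  exists alpha => z; rewrite fE gE.
  exact: (extension_eq_of_samples B0 c0 cB bF bG ratio).
(* Here [ft G] vanishes on the real line, and so does [ft F] by equality of moduli; all samples are
   zero, so any phase matches them and 0 is taken. *)
exists 0 => z; rewrite fE gE.
apply: (@extension_eq_of_samples _ _ B0 c 0) => // n.
rewrite G0 mulr0; apply/eqP; rewrite -cnorm2_eq0 modulus G0 cnorm2_eq0.
by [].
Qed.
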